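(* Let $X,U$ be Hilbert spaces, let $A$ generate a strongly continuous semigroup $T(t)$ on $X$, let $B\in\mathcal{B}(U,X)$, let $F\in\mathcal{B}(X,U)$ be compact, and let $\phi:X\to X$ satisfy $\phi(0)=0$ and $\|\phi(\xi_1)-\phi(\xi_2)\|\le L\|\xi_1-\xi_2\|$ for all $\xi_1,\xi_2\in X$, where $L\ge0$. Assume that the semigroup $T_{BF}(t)$ generated by $A+BF$ satisfies $\|T_{BF}(t)\|_{\mathcal{B}(X)}\le\Gamma e^{-\gamma t}$ for all $t\ge0$, for some $\Gamma\ge1$ and $\gamma>0$. For $h>0$ define $$W(h):=\Gamma e^{\gamma h}\sup_{0\le t\le h}\big\|T(h-t)BF[I-T_{BF}(t)]\big\|_{\mathcal{B}(X)},$$ and assume that $S_hF\ne0$ for every $h>0$ satisfying $W(h)<\gamma$. Then the closed-loop system with the periodic event-triggering mechanism (described in the context) with parameters $h,\varepsilon,\ell_{\max}$ is exponentially stable for every $\ell_{\max}\in\mathbb{N}$ if $h>0$ and $L,\varepsilon\ge0$ satisfy $$\varepsilon<\frac{[\gamma-W(h)]e^{-\gamma h}h-c_1\Gamma(e^{c_2Lh}-1)}{\Gamma\big(\|S_hF\|_{\mathcal{B}(X)}+c_3(e^{c_2Lh}-1)\big)},$$ where $$c_1:=\sup_{0\le\tau\le h}\|\Delta_\tau\|_{\mathcal{B}(X)},\quad c_2:=\sup_{0\le\tau\le h}\|T(\tau)\|_{\mathcal{B}(X)},\quad c_3:=\sup_{0\le\tau\le h}\|S_\tau F\|_{\mathc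al{B}(X)}.$$
   Context: $\mathcal{B}(Y,Z)$ is the space of bounded linear operators from $Y$ to $Z$, $\mathcal{B}(X)=\mathcal{B}(X,X)$, $\mathbb{N}=\{1,2,\dots\}$, $\mathbb{N}_0=\mathbb{N}\cup\{0\}$, and $\|\cdot\|$ is the norm of $X$. Operators: $S_\tau:=\int_0^\tau T(s)B\,ds$ and $\Delta_\tau:=T(\tau)+S_\tau F$. Closed-loop system: $\dot x(t)=Ax(t)+Bu(t)+\phi(x(t))$, $t\ge0$, $x(0)=x^0\in X$, with $u(t)=Fx(t_k)$ for $t_k\le t<t_{k+1}$, $k\in\mathbb{N}_0$. Its (mild) solution is the unique function $x\in C([0,\infty),X)$ with $x(0)=x^0$ and $$x(t_k+\tau)=T(\tau)x(t_k)+\int_0^\tau T(\tau-s)\big(BFx(t_k)+\phi(x(t_k+s))\big)ds$$ for all $\tau\in(0,t_{k+1}-t_k]$, $k\in\mathbb{N}_0$. Periodic event-triggering mechanism with sampling period $h>0$, threshold $\varepsilon\ge0$ and $\ell_{\max}\in\mathbb{N}$: $t_0:=0$, $t_{k+1}:=\min\{t_k+\ell_{\max}h,\bar t_{k+1}\}$, where $$\bar t_{k+1}:=\min\{\ell h>t_k:\|x(\ell h)-x(t_k)\|>\varepsilon\|x(t_k)\|,\ \ell\in\mathbb{N}\},\quad k\in\mathbb{N}_0$$ (with $\min\emptyset=\infty$). The times and the solution are generated recursively: in the definition of $\bar t_{k+1}$, $x(\ell h)$ for $\ell h>t_k$ is the value of the trajectory obtained by keeping the input $u=Fx(t_k)$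 after $t_k$. Exponential stability of the closed-loop system: there exist constants $\Gamma_0\ge1$, $\gamma_0>0$ such that the solution satisfies $\|x(t)\|\le\Gamma_0e^{-\gamma_0t}\|x^0\|$ for all $x^0\in X$ and all $t\ge0$. *)

(* Defs.v *)
From Stdlib Require Import Reals.
From Coquelicot Require Import Coquelicot.

Set Implicit Arguments.
Unset Strict Implicit.
Unset Printing Implicit Defensive.

Open Scope R_scope.

(** * Real and complex Hilbert spaces *)

Inductive scalar_field := RealScalars | ComplexScalars.

Definition scalars (k : scalar_field) : AbsRing :=
  match k with
  | RealScalars => R_AbsRing
  | ComplexScalars => C_AbsRing
  end.

Definition of_real (k : scalar_field) : R -> scalars k :=
  match k with
  | RealScalars => fun r => r
  | ComplexScalars => RtoC
  end.

Definition scalar_conj (k : scalar_field) : scalars k -> scalars k :=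
  match k with
  | RealScalars => fun z => z
  | ComplexScalars => Cconj
  end.

Record HilbertSpace (k : scalar_field) := {
  hilbert_carrier :> CompleteNormedModule (scalars k);
  inner : hilbert_carrier -> hilbert_carrier -> scalars k;
  inner_plus_l : forall x y z : hilbert_carrier,
    inner (plus x y) z = plus (inner x z) (inner y z);
  inner_scal_l : forall (a : scalars k) (x y : hilbert_carrier),
    inner (scal a x) y = mult a (inner x y);
  inner_conj : forall x y : hilbert_carrier,
    inner y x = scalar_conj (inner x y);
  inner_norm : forall x : hilbert_carrier,
    inner x x = of_real k (norm x ^ 2)
}.

(** ** Restriction of scalars to the reals

    Coquelicot's Riemann integral [RInt] takes values in modules over
    [R_AbsRing].  [real_module X] is [X] with the same group, uniform structure
    and norm, and with scalar multiplication restricted to the reals. *)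

Lemma of_real_mult k (x y : R) :
  of_real k (x * y) = mult (of_real k x) (of_real k y).
Proof. destruct k; [reflexivity | exact (RtoC_mult x y)]. Qed.

Lemma of_real_plus k (x y : R) :
  of_real k (x + y) = plus (of_real k x) (of_real k y).
Proof. destruct k; [reflexivity | exact (RtoC_plus x y)]. Qed.

Lemma of_real_one k : of_real k 1 = one.
Proof. destruct k; reflexivity. Qed.

Lemma abs_of_real k (x : R) : abs (of_real k x) = Rabs x.
Proof. destruct k; [reflexivity | exact (Cmod_R x)]. Qed.

Section RestrictScalars.

Context (k : scalar_field) (X : CompleteNormedModule (scalars k)).

Definition real_scal (r : R) (x : X) : X := scal (of_real k r) x.

Lemma real_scal_assoc (r s : R) (x : X) :
  real_scal r (real_scal s x) = real_scal (r * s) x.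
Proof. unfold real_scal; rewrite of_real_mult; apply scal_assoc. Qed.

Lemma real_scal_one (x : X) : real_scal 1 x = x.
Proof. unfold real_scal; rewrite of_real_one; apply scal_one. Qed.

Lemma real_scal_distr_l (r : R) (x y : X) :
  real_scal r (plus x y) = plus (real_scal r x) (real_scal r y).
Proof. exact (scal_distr_l (of_real k r) x y). Qed.

Lemma real_scal_distr_r (r s : R) (x : X) :
  real_scal (r + s) x = plus (real_scal r x) (real_scal s x).
Proof. unfold real_scal; rewrite of_real_plus; exact (scal_distr_r (of_real k r) (of_real k s) x). Qed.

Lemma norm_real_scal (r : R) (x : X) :
  norm (real_scal r x) <= Rabs r * norm x.
Proof.
  unfold real_scal; rewrite <- (abs_of_real k r).
  exact (norm_scal (of_real k r) x).
Qed.

Definition real_ModuleSpace : ModuleSpace R_Ring :=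
  ModuleSpace.Pack R_Ring X
    (ModuleSpace.Class R_Ring X _
       (ModuleSpace.Mixin R_Ring X real_scal real_scal_assoc real_scal_one
          real_scal_distr_l real_scal_distr_r)) X.

Definition real_NormedModuleAux : NormedModuleAux R_AbsRing :=
  NormedModuleAux.Pack R_AbsRing X
    (NormedModuleAux.Class R_AbsRing X (ModuleSpace.class _ real_ModuleSpace)
       (UniformSpace.class X)) X.

Definition real_NormedModule_mixin :
    NormedModule.mixin_of R_AbsRing real_NormedModuleAux :=
  NormedModule.Mixin R_AbsRing real_NormedModuleAux
    (fun x : X => norm x) (@norm_factor (scalars k) X)
    (@norm_triangle (scalars k) X) norm_real_scal
    (@norm_compat1 (scalars k) X) (@norm_compat2 (scalars k) X)
    (@norm_eq_zero (scalars k) X).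

Definition real_module : CompleteNormedModule R_AbsRing :=
  CompleteNormedModule.Pack R_AbsRing X
    (CompleteNormedModule.Class R_AbsRing X
       (NormedModule.Class R_AbsRing X
          (NormedModuleAux.class _ real_NormedModuleAux)
          real_NormedModule_mixin)
       (CompleteNormedModule.mixin _ _ (CompleteNormedModule.class _ X))) X.

(** [RInt] returns a junk value when the integrand is not integrable; every
    integrand below is continuous on its interval of integration. *)
Definition integral (f : R -> X) (a b : R) : X :=
  @RInt real_module f a b.

End RestrictScalars.

(** * Operators *)

(** The operator norm [sup { norm (l x) | norm x <= 1 }].  The supremum is taken
    in the extended reals and projected by [real], which sends infinity to [0];
    it is finite whenever [l] is bounded. *)
Definition opnorm (k : scalar_field) (X Y : HilbertSpace k) (l : X -> Y) : R :=
  real (Lub_Rbar (fun r => exists x : X, norm x <= 1 /\ r = norm (l x))).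

(** [sup { g s | a <= s <= b }], with the same convention. *)
Definition sup_on (a b : R) (g : R -> R) : R :=
  real (Lub_Rbar (fun r => exists s, a <= s <= b /\ r = g s)).

Definition compact_operator (k : scalar_field) (X Y : HilbertSpace k)
    (l : X -> Y) : Prop :=
  is_linear l /\
  forall x : nat -> X, (exists M, forall n, norm (x n) <= M) ->
    exists (sub : nat -> nat) (y : Y),
      (forall n, (sub n < sub (S n))%nat) /\
      filterlim (fun n => l (x (sub n))) eventually (locally y).

(** A possibly unbounded operator; the values of [app] outside [dom] are
    irrelevant. *)
Record partial_operator (k : scalar_field) (X : HilbertSpace k) := {
  dom : X -> Prop;
  app : X -> X
}.

Definition bounded_perturbation (k : scalar_field) (X : HilbertSpace k)
    (A : partial_operator X) (P : X -> X) : partial_operator X :=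
  {| dom := dom A; app := fun x => plus (app A x) (P x) |}.

(** * Strongly continuous semigroups *)

(** Only the values [T t] with [0 <= t] are meaningful. *)
Definition C0_semigroup (k : scalar_field) (X : HilbertSpace k)
    (T : R -> X -> X) : Prop :=
  (forall t, 0 <= t -> is_linear (T t)) /\
  (forall x, T 0 x = x) /\
  (forall s t x, 0 <= s -> 0 <= t -> T (s + t) x = T s (T t x)) /\
  (forall x, filterlim (fun t => T t x) (at_right 0) (locally x)).

Definition generates (k : scalar_field) (X : HilbertSpace k)
    (A : partial_operator X) (T : R -> X -> X) : Prop :=
  C0_semigroup T /\
  forall x y : X,
    (dom A x /\ app A x = y) <->
    filterlim (fun t => real_scal (/ t) (minus (T t x) x))
      (at_right 0) (locally y).

(** * The sampled-data operators *)

(** [S_tau = int_0^tau T(s) B ds], as a strong integral. *)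
Definition S_op (k : scalar_field) (X U : HilbertSpace k) (T : R -> X -> X)
    (B : U -> X) (tau : R) (u : U) : X :=
  integral (fun s => T s (B u)) 0 tau.

Definition Delta_op (k : scalar_field) (X U : HilbertSpace k) (T : R -> X -> X)
    (B : U -> X) (F : X -> U) (tau : R) (x : X) : X :=
  plus (T tau x) (S_op T B tau (F x)).

Definition W (k : scalar_field) (X U : HilbertSpace k) (T TBF : R -> X -> X)
    (B : U -> X) (F : X -> U) (Gamma gamma h : R) : R :=
  Gamma * exp (gamma * h) *
  sup_on 0 h (fun t =>
    opnorm (fun x : X => T (h - t) (B (F (minus x (TBF t x)))))).

(** * The closed-loop system *)

(** The mild formula at time [tau] for [y' = A y + B u + phi(y)], [y 0 = xi],
    with constant input [u]. *)
Definition mild_formula (k : scalar_field) (X U : HilbertSpace k)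
    (T : R -> X -> X) (B : U -> X) (phi : X -> X)
    (u : U) (xi : X) (y : R -> X) (tau : R) : Prop :=
  y tau = plus (T tau xi)
    (integral (fun s => T (tau - s) (plus (B u) (phi (y s)))) 0 tau).

Definition held_trajectory (k : scalar_field) (X U : HilbertSpace k)
    (T : R -> X -> X) (B : U -> X) (phi : X -> X)
    (u : U) (xi : X) (y : R -> X) : Prop :=
  y 0 = xi /\
  continuous_on (fun s => 0 <= s) y /\
  forall tau, 0 < tau -> mild_formula T B phi u xi y tau.

(** The minimum of a set of reals, with [min empty = +infinity]. *)
Definition is_min (E : R -> Prop) (m : Rbar) : Prop :=
  match m with
  | Finite r => E r /\ forall s, E s -> r <= s
  | p_infty => forall s, ~ E s
  | m_infty => False
  end.

(** The times [l h > tk] at which the threshold is exceeded; [y] is the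
    trajectory held from [tk] on, in the shifted time variable. *)
Definition violation_times (k : scalar_field) (X : HilbertSpace k)
    (h eps tk : R) (y : R -> X) (s : R) : Prop :=
  exists l : nat, (1 <= l)%nat /\ s = INR l * h /\ s > tk /\
    norm (minus (y (s - tk)) (y 0)) > eps * norm (y 0).

Definition next_update_time (k : scalar_field) (X : HilbertSpace k)
    (h eps : R) (lmax : nat) (tk : R) (y : R -> X) (tk1 : R) : Prop :=
  exists tbar : Rbar,
    is_min (violation_times h eps tk y) tbar /\
    Finite tk1 = Rbar_min (Finite (tk + INR lmax * h)) tbar.

(** [x] is a solution with initial state [x0] and [t] is the sequence of update
    times produced along it by the periodic event-triggering mechanism. *)
Definition closed_loop_solution (k : scalar_field) (X U : HilbertSpace k)
    (T : R -> X -> X) (B : U -> X) (F : X -> U) (phi : X -> X)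
    (h eps : R) (lmax : nat) (x0 : X) (x : R -> X) (t : nat -> R) : Prop :=
  x 0 = x0 /\
  continuous_on (fun s => 0 <= s) x /\
  t 0%nat = 0 /\
  forall n : nat,
    (exists y : R -> X,
       held_trajectory T B phi (F (x (t n))) (x (t n)) y /\
       next_update_time h eps lmax (t n) y (t (S n))) /\
    (forall tau, 0 < tau <= t (S n) - t n ->
       mild_formula T B phi (F (x (t n))) (x (t n))
         (fun s => x (t n + s)) tau).

Definition exponentially_stable (k : scalar_field) (X U : HilbertSpace k)
    (T : R -> X -> X) (B : U -> X) (F : X -> U) (phi : X -> X)
    (h eps : R) (lmax : nat) : Prop :=
  exists Gamma0 gamma0 : R, 1 <= Gamma0 /\ 0 < gamma0 /\
    forall (x0 : X) (x : R -> X) (t : nat -> R),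
      closed_loop_solution T B F phi h eps lmax x0 x t ->
      forall s, 0 <= s -> norm (x s) <= Gamma0 * exp (- gamma0 * s) * norm x0.

(* Main.v *)
Require Import Defs.
From Stdlib Require List.
From Stdlib Require Import Reals Lra Lia Classical IndefiniteDescription.
From Coquelicot Require Import Coquelicot.

Open Scope R_scope.

(** Everything happens in the real Banach space underlying [X], with
    [P = B F]; [Q] stands for the semigroup generated by [A + P].

    Between two samples the linear part of the loop is the map
    [Delta_h x = T(h) x + int_0^h T(s) P x ds], which is compared with [Q(h)].
    The path [s |-> T(h - s) Q(s) x + int_0^(h - s) T P x] joins [Delta_h x] to
    [Q(h) x], and for [x] in the domain of the generator its right derivative is
    [T(h - s) P (Q(s) x - x)]; the mean value inequality and the density of the
    domain give [|Q(h) x - Delta_h x| <= w h |x|], where [w] is the supremum in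
    [W(h) = Gamma e^(gamma h) w] ([sampled_map_near]).  In the equivalent norm
    [N x = sup_t e^(gamma t) |Q(t) x|], for which [Q(h)] contracts by
    [e^(-gamma h)], this makes [Delta_h] contract by
    [theta = 1 - (gamma - W(h)) e^(-gamma h) h] ([sampled_map_contraction]).

    Two perturbations act on one sampling step: the error between the current
    sample and the state at the last update, of size at most [eps] times that
    state, and the nonlinearity, which Gronwall's inequality bounds
    ([mild_on_near_linear]).  If [xi] is the state at the last update, then
    [N x((l+1)h) <= alpha N x(lh) + beta N xi] ([sampling_step]), and the bound
    on [eps] says exactly that [alpha + beta < 1].  Hence every sample after an
    update, up to and including the next update, has at most [alpha + beta]
    times the norm [N] of [xi] ([held_interval_contraction]).  Updates are at
    most [lmax h] apart, so the state decays exponentially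
    ([sampled_loop_decay]).

    The event-triggering rule is phrased with the trajectory obtained by holding
    the input; by uniqueness of mild solutions it agrees with the solution until
    the next update ([closed_loop_grid]).

    The suprema [c1], [c2], [c3] and [w] are meaningful only if they are finite,
    that is, if [T] is bounded in operator norm on [[0, h]].  This is a
    consequence of strong continuity through the uniform boundedness principle
    ([uniform_boundedness], [sg_bounded]).

    Finally, the quotient bounding [eps] is nonpositive when [gamma <= W(h)], so
    that case does not occur, and when [W(h) < gamma] its denominator is positive
    because [S_h F] is not zero. *)

(** * Linear identities in real normed modules *)

Section LinearIdentities.

Context {V : CompleteNormedModule R_AbsRing}.

Inductive vexp :=
  | VVar (n : nat)
  | VZero
  | VPlus (a b : vexp)
  | VOpp (a : vexp)
  | VScal (r : R) (a : vexp).

Fixpoint veval (env : list V) (e : vexp) : V :=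
  match e with
  | VVar n => List.nth n env zero
  | VZero => zero
  | VPlus a b => plus (veval env a) (veval env b)
  | VOpp a => opp (veval env a)
  | VScal r a => scal r (veval env a)
  end.

Fixpoint vcoef (e : vexp) (i : nat) : R :=
  match e with
  | VVar n => if Nat.eqb n i then 1 else 0
  | VZero => 0
  | VPlus a b => vcoef a i + vcoef b i
  | VOpp a => - vcoef a i
  | VScal r a => r * vcoef a i
  end.

Fixpoint lin_comb (env : list V) (c : nat -> R) : V :=
  match env with
  | nil => zero
  | cons v l => plus (scal (c 0%nat) v) (lin_comb l (fun i => c (S i)))
  end.

Lemma lin_comb_ext env : forall c d,
  (forall i, c i = d i) -> lin_comb env c = lin_comb env d.
Proof.
  induction env as [|v l IH]; intros c d H; simpl; [reflexivity|].
  rewrite H; f_equal; apply IH; intros i; apply H.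
Qed.

Lemma lin_comb_zero env : lin_comb env (fun _ => 0) = zero.
Proof.
  induction env as [|v l IH]; simpl; [reflexivity|].
  rewrite IH, plus_zero_r; exact (scal_zero_l v).
Qed.

Lemma lin_comb_plus env : forall c d,
  lin_comb env (fun i => c i + d i) = plus (lin_comb env c) (lin_comb env d).
Proof.
  induction env as [|v l IH]; intros c d; simpl; [now rewrite plus_zero_l|].
  rewrite IH, (scal_distr_r (c 0%nat) (d 0%nat) v : scal (c 0%nat + d 0%nat) v = _).
  rewrite <- !plus_assoc; f_equal.
  rewrite !plus_assoc; f_equal; apply plus_comm.
Qed.

Lemma lin_comb_scal env : forall r c,
  lin_comb env (fun i => r * c i) = scal r (lin_comb env c).
Proof.
  induction env as [|v l IH]; intros r c; simpl.
  - symmetry; exact (scal_zero_r r).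
  - rewrite IH.
    rewrite (scal_distr_l r (scal (c 0%nat) v) _); f_equal.
    symmetry; exact (scal_assoc r (c 0%nat) v).
Qed.

Lemma lin_comb_var env : forall n,
  lin_comb env (fun i => if Nat.eqb n i then 1 else 0) = List.nth n env zero.
Proof.
  induction env as [|v l IH]; intros n; simpl; [now destruct n|].
  destruct n as [|n]; simpl.
  - rewrite lin_comb_zero, plus_zero_r; exact (scal_one v).
  - rewrite IH.
    replace (scal 0 v) with (zero : V) by (symmetry; exact (scal_zero_l v)).
    apply plus_zero_l.
Qed.

Lemma veval_lin_comb env e : veval env e = lin_comb env (vcoef e).
Proof.
  induction e as [n| |a IHa b IHb|a IHa|r a IHa]; simpl.
  - now rewrite <- lin_comb_var.
  - now rewrite lin_comb_zero.
  - now rewrite lin_comb_plus, IHa, IHb.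
  - rewrite (lin_comb_ext env _ (fun i => (-1) * vcoef a i)) by (intros; ring).
    rewrite lin_comb_scal, IHa.
    symmetry; exact (scal_opp_one (lin_comb env (vcoef a))).
  - now rewrite lin_comb_scal, IHa.
Qed.

Fixpoint coef_eqs (n : nat) (c d : nat -> R) : Prop :=
  match n with
  | O => True
  | S n => c 0%nat = d 0%nat /\ coef_eqs n (fun i => c (S i)) (fun i => d (S i))
  end.

Lemma veval_eq env e1 e2 :
  coef_eqs (length env) (vcoef e1) (vcoef e2) -> veval env e1 = veval env e2.
Proof.
  rewrite !veval_lin_comb.
  generalize (vcoef e1) (vcoef e2).
  induction env as [|v l IH]; intros c d; simpl; [reflexivity|].
  intros [-> H]; f_equal; now apply IH.
Qed.

End LinearIdentities.

Ltac vec_lookup x l :=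
  match l with
  | cons x _ => constr:(O)
  | cons _ ?l' => let n := vec_lookup x l' in constr:(S n)
  end.

Ltac vec_add x l :=
  match l with
  | context [cons x _] => l
  | _ => constr:(cons x l)
  end.

Ltac vec_atoms e l :=
  match e with
  | plus ?a ?b => let l := vec_atoms a l in vec_atoms b l
  | minus ?a ?b => let l := vec_atoms a l in vec_atoms b l
  | opp ?a => vec_atoms a l
  | scal _ ?a => vec_atoms a l
  | zero => l
  | _ => vec_add e l
  end.

Ltac vec_reify e l :=
  match e with
  | plus ?a ?b =>
      let a := vec_reify a l in let b := vec_reify b l in constr:(VPlus a b)
  | minus ?a ?b =>
      let a := vec_reify a l in let b := vec_reify b l in
      constr:(VPlus a (VOpp b))
  | opp ?a => let a := vec_reify a l in constr:(VOpp a)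
  | scal ?r ?a => let a := vec_reify a l in constr:(VScal r a)
  | zero => constr:(VZero)
  | _ => let n := vec_lookup e l in constr:(VVar n)
  end.

(** Both sides are reified over a common list of atoms; what remains is one
    scalar identity per atom. *)
Ltac vec V :=
  match goal with
  | |- ?a = ?b =>
      let l0 := constr:(@nil (CompleteNormedModule.sort _ V)) in
      let l := vec_atoms a l0 in
      let l := vec_atoms b l in
      let ea := vec_reify a l in
      let eb := vec_reify b l in
      change (@veval V l ea = @veval V l eb);
      apply veval_eq; cbn -[Rplus Rmult Ropp Rinv Rminus Rdiv];
      repeat split; try ring; try (field; lra)
  end.

(** * Norms, limits and bounded linear maps *)

Section Norms.

Context {V : CompleteNormedModule R_AbsRing}.

(** This lemma and the next ones restate general facts with the operations that
    type inference picks for a complete normed module over [R], so that every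
    term below has the same form. *)
Lemma norm_triangle_R (x y : V) : norm (plus x y) <= norm x + norm y.
Proof. exact (norm_triangle x y). Qed.

Lemma norm_opp_R (x : V) : norm (opp x) = norm x.
Proof. exact (norm_opp x). Qed.

Lemma norm_zero_R : norm (zero : V) = 0.
Proof. exact norm_zero. Qed.

Lemma norm_eq_zero_R (x : V) : norm x = 0 -> x = zero.
Proof. exact (norm_eq_zero x). Qed.

Lemma norm_scal_eq (r : R) (x : V) : norm (scal r x) = Rabs r * norm x.
Proof.
  apply Rle_antisym; [exact (norm_scal r x)|].
  destruct (Req_dec r 0) as [->|Hr].
  - rewrite Rabs_R0, Rmult_0_l; apply norm_ge_0.
  - assert (H : norm (scal (/ r) (scal r x)) <= Rabs (/ r) * norm (scal r x))
      by exact (norm_scal (/ r) (scal r x)).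
    replace (scal (/ r) (scal r x)) with x in H by (vec V).
    rewrite Rabs_inv in H.
    apply Rmult_le_reg_l with (/ Rabs r); [now apply Rinv_0_lt_compat, Rabs_pos_lt|].
    rewrite <- Rmult_assoc, Rinv_l, Rmult_1_l by now apply Rabs_no_R0.
    exact H.
Qed.

(** The equation is left to the user because the triangle inequality is mostly
    applied to a sum that is equal to, but not displayed as, [plus x y]. *)
Lemma norm_le_plus (z x y : V) : z = plus x y -> norm z <= norm x + norm y.
Proof. intros ->; apply norm_triangle_R. Qed.

Lemma norm_minus_sym (x y : V) : norm (minus x y) = norm (minus y x).
Proof.
  rewrite <- (norm_opp_R (minus y x)); f_equal; vec V.
Qed.

Lemma norm_minus_le (x y : V) : norm (minus x y) <= norm x + norm y.
Proof.
  rewrite <- (norm_opp_R y); apply (norm_triangle_R x (opp y)).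
Qed.

Lemma norm_le_minus (x y : V) : norm x <= norm (minus x y) + norm y.
Proof.
  apply norm_le_plus; vec V.
Qed.

Lemma norm_minus_self (x : V) : norm (minus x x) = 0.
Proof. replace (minus x x) with (zero : V) by (vec V); apply norm_zero_R. Qed.

Lemma filterlim_norm_le {A : Type} {F : (A -> Prop) -> Prop} {FF : Filter F}
    (f : A -> V) (y : V) :
  filterlim f F (locally y) <->
  forall eta, 0 < eta -> F (fun a => norm (minus (f a) y) < eta).
Proof.
  destruct (filterlim_locally_ball_norm (F := F) f y) as [H1 H2]; split.
  - intros H eta Heta; exact (H1 H (mkposreal eta Heta)).
  - intros H; apply H2; intros [eta Heta]; exact (H eta Heta).
Qed.

Lemma continuous_norm_lt (f : R -> V) (s : R) :
  continuous f s <->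
  forall eta, 0 < eta -> exists delta, 0 < delta /\
    forall t, Rabs (t - s) < delta -> norm (minus (f t) (f s)) < eta.
Proof.
  unfold continuous; destruct (filterlim_norm_le (F := locally s) f (f s)) as [H1 H2];
  split.
  - intros H eta Heta; destruct (H1 H eta Heta) as [[d Hd] H3].
    exists d; split; [exact Hd|]; intros t Ht; apply H3, Ht.
  - intros H; apply H2; intros eta Heta; destruct (H eta Heta) as [d [Hd H3]].
    exists (mkposreal d Hd); intros t Ht; apply H3, Ht.
Qed.

Lemma at_right_0_norm_lt (f : R -> V) (y : V) :
  filterlim f (at_right 0) (locally y) ->
  forall eta, 0 < eta -> exists delta, 0 < delta /\
    forall t, 0 < t < delta -> norm (minus (f t) y) < eta.
Proof.
  intros H eta Heta.
  destruct (proj1 (filterlim_norm_le f y) H eta Heta) as [[d Hd] H1].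
  exists d; split; [exact Hd|]; intros t [Ht0 Ht]; apply H1; [|exact Ht0].
  change (Rabs (t - 0) < d); rewrite Rminus_0_r, Rabs_pos_eq; lra.
Qed.

Lemma linear_plus_R {Y : CompleteNormedModule R_AbsRing} (l : V -> Y) (x y : V) :
  is_linear l -> l (plus x y) = plus (l x) (l y).
Proof. intros Hl; exact (linear_plus l Hl x y). Qed.

Lemma linear_scal_R {Y : CompleteNormedModule R_AbsRing} (l : V -> Y) (r : R) (x : V) :
  is_linear l -> l (scal r x) = scal r (l x).
Proof. intros Hl; exact (linear_scal l Hl r x). Qed.

Lemma linear_minus {Y : CompleteNormedModule R_AbsRing} (l : V -> Y) (x y : V) :
  is_linear l -> l (minus x y) = minus (l x) (l y).
Proof.
  intros Hl.
  replace (minus x y) with (plus x (scal (-1) y)) by (vec V).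
  rewrite (linear_plus_R _ _ _ Hl).
  rewrite (linear_scal_R l (-1) y Hl).
  vec Y.
Qed.

End Norms.

(** * The uniform boundedness principle *)

Section UniformBoundedness.

Context {V : CompleteNormedModule R_AbsRing} {Y : CompleteNormedModule R_AbsRing}.

Lemma nested_balls (c : nat -> V) (r : nat -> R) :
  (forall n, 0 < r n) ->
  (forall n, r (S n) <= r n / 2) ->
  (forall n, norm (minus (c (S n)) (c n)) + r (S n) <= r n) ->
  exists x, forall n, norm (minus x (c n)) <= r n.
Proof.
  intros Hr Hhalf Hin.
  assert (Hsub : forall n m, norm (minus (c (n + m)%nat) (c n)) + r (n + m)%nat <= r n).
  { intros n m; induction m as [|m IH].
    - rewrite Nat.add_0_r, norm_minus_self; lra.
    - rewrite Nat.add_succ_r; specialize (Hin (n + m)%nat).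
      enough (norm (minus (c (S (n + m))) (c n)) <=
        norm (minus (c (S (n + m))) (c (n + m)%nat))
          + norm (minus (c (n + m)%nat) (c n))) by lra.
      apply norm_le_plus; vec V. }
  assert (Hpow : forall n, r n <= r 0%nat * (/ 2) ^ n).
  { induction n as [|n IH]; simpl; [lra|]; specialize (Hhalf n); lra. }
  destruct (proj1 (filterlim_locally_cauchy (F := eventually) c)) as [x Hx].
  { intros [eta Heta].
    assert (Hlim : is_lim_seq (fun n => r 0%nat * (/ 2) ^ n) 0).
    { replace 0 with (r 0%nat * 0) by ring.
      apply (is_lim_seq_scal_l _ (r 0%nat) 0).
      apply is_lim_seq_geom; rewrite Rabs_pos_eq; lra. }
    apply is_lim_seq_spec in Hlim.
    destruct (Hlim (mkposreal (eta / 2) ltac:(lra))) as [N HN].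
    exists (fun n => (N <= n)%nat); split; [now exists N|].
    assert (HrN : r N < eta / 2).
    { specialize (HN N (Nat.le_refl _)); simpl in HN.
      rewrite Rminus_0_r in HN; specialize (Hpow N).
      pose proof (Rle_abs (r 0%nat * (/ 2) ^ N)); lra. }
    assert (Hclose : forall n, (N <= n)%nat -> norm (minus (c n) (c N)) < eta / 2).
    { intros n Hn; pose proof (Hsub N (n - N)%nat) as H1.
      replace (N + (n - N))%nat with n in H1 by lia.
      specialize (Hr n); lra. }
    intros u v Hu Hv; apply (norm_compat1 (c u) (c v)); simpl.
    enough (norm (minus (c v) (c u)) <=
      norm (minus (c v) (c N)) + norm (minus (c N) (c u))).
    { rewrite (norm_minus_sym (c N) (c u)) in H.
      pose proof (Hclose u Hu); specialize (Hclose v Hv).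
      now apply Rle_lt_trans with (1 := H); lra. }
    apply norm_le_plus; vec V. }
  exists x; intros n.
  apply Rnot_lt_le; intros Hlt.
  pose proof (proj1 (filterlim_norm_le c x) Hx) as Hx'.
  destruct (Hx' (norm (minus x (c n)) - r n)) as [N HN]; [lra|].
  specialize (HN (n + N)%nat (Nat.le_add_l _ _)).
  specialize (Hsub n N); specialize (Hr (n + N)%nat).
  rewrite norm_minus_sym in HN.
  enough (norm (minus x (c n)) <=
    norm (minus x (c (n + N)%nat)) + norm (minus (c (n + N)%nat) (c n))) by lra.
  apply norm_le_plus; vec V.
Qed.

(** If an operator takes a large value at [w], then it takes a large value at
    [c + w] or at [c - w]; being bounded, it stays large on a ball around that
    point. *)
Lemma unbounded_on_smaller_ball {I : Type} (l : I -> V -> Y) :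
  (forall i, is_linear (l i)) ->
  (forall M, exists i x, norm (l i x) > M * norm x) ->
  forall (K : R) (c : V) (r : R), 0 < r ->
  exists i c' r', 0 < r' <= r / 2 /\
    norm (minus c' c) + r' <= r /\
    forall z, norm (minus z c') <= r' -> K <= norm (l i z).
Proof.
  intros Hlin Hunb K c r Hr.
  set (K1 := Rabs K + 1).
  assert (HK1 : 0 < K1) by (unfold K1; pose proof (Rabs_pos K); lra).
  destruct (Hunb (K1 / (r / 2))) as [i [u Hu]].
  assert (Hux : 0 < norm u).
  { destruct (norm_ge_0 u) as [H|H]; [exact H|].
    rewrite (norm_eq_zero_R u) in Hu by now symmetry.
    assert (H0 : l i zero = zero).
    { replace (zero : V) with (scal 0 (zero : V)) by exact (scal_zero_l _).
      rewrite (linear_scal_R _ _ _ (Hlin i)); exact (scal_zero_l _). }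
    rewrite H0, !norm_zero_R in Hu; lra. }
  destruct (linear_norm _ (Hlin i)) as [M [HM HMb]].
  set (w := scal (r / 2 / norm u) u).
  assert (Hw : norm w = r / 2).
  { unfold w; rewrite norm_scal_eq, Rabs_pos_eq; [field; lra|].
    apply Rlt_le, Rdiv_lt_0_compat; lra. }
  assert (Hlw : K1 < norm (l i w)).
  { unfold w; rewrite (linear_scal_R _ _ _ (Hlin i)), norm_scal_eq, Rabs_pos_eq
      by (apply Rlt_le, Rdiv_lt_0_compat; lra).
    apply (Rmult_lt_compat_l (r / 2 / norm u)) in Hu;
      [|apply Rdiv_lt_0_compat; lra].
    replace (r / 2 / norm u * (K1 / (r / 2) * norm u)) with K1 in Hu
      by (field; lra).
    exact Hu. }
  assert (Hc' : exists c', norm (minus c' c) <= r / 2 /\ K1 <= norm (l i c')).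
  { destruct (Rle_lt_dec K1 (norm (l i (plus c w)))) as [H|H].
    - exists (plus c w); split; [|exact H].
      rewrite <- Hw; apply Req_le; f_equal; vec V.
    - exists (minus c w); split.
      + rewrite <- Hw, <- norm_opp_R; apply Req_le; f_equal; vec V.
      + (* [l w] is half the difference of the values at [c + w] and [c - w] *)
        assert (Hd : l i (plus c w) = plus (l i (minus c w)) (scal 2 (l i w))).
        { rewrite <- (linear_scal_R _ _ _ (Hlin i)), <- (linear_plus_R _ _ _ (Hlin i)).
          f_equal; vec V. }
        assert (H1 : norm (scal 2 (l i w)) <=
          norm (l i (plus c w)) + norm (opp (l i (minus c w)))).
        { apply norm_le_plus; rewrite Hd; vec Y. }
        rewrite norm_opp_R, norm_scal_eq, Rabs_pos_eq in H1 by lra; lra. }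
  destruct Hc' as [c' [Hcc' Hlc']].
  exists i, c', (Rmin (r / 2) (/ M)).
  assert (0 < / M) by now apply Rinv_0_lt_compat.
  pose proof (Rmin_l (r / 2) (/ M)); pose proof (Rmin_r (r / 2) (/ M)).
  split; [split; [apply Rmin_pos; lra|lra]|split; [lra|]].
  intros z Hz.
  pose proof (HMb (minus c' z)) as Hdiff.
  rewrite norm_minus_sym in Hdiff.
  assert (Hsum : norm (l i c') <= norm (l i (minus c' z)) + norm (l i z)).
  { apply norm_le_plus; rewrite (linear_minus _ _ _ (Hlin i)); vec Y. }
  assert (M * norm (minus z c') <= 1).
  { apply Rle_trans with (M * / M); [apply Rmult_le_compat_l; lra|].
    rewrite Rinv_r; lra. }
  unfold K1 in *; pose proof (Rle_abs K); lra.
Qed.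

(** If the norms were unbounded, shrinking balls on which some [l i] exceeds
    [n] would meet in a point where the family is not bounded. *)
Theorem uniform_boundedness {I : Type} (l : I -> V -> Y) :
  (forall i, is_linear (l i)) ->
  (forall x, exists M, forall i, norm (l i x) <= M) ->
  exists M, forall i x, norm (l i x) <= M * norm x.
Proof.
  intros Hlin Hpt; apply NNPP; intros Hno.
  assert (Hunb : forall M, exists i x, norm (l i x) > M * norm x).
  { intros M; apply NNPP; intros H; apply Hno; exists M; intros i x.
    apply Rnot_lt_le; intros H1; apply H; now exists i, x. }
  pose (ball := {p : V * R | 0 < snd p}).
  assert (Hstep : forall q : nat * ball, exists p' : ball,
    let (n, p) := q in
    snd (proj1_sig p') <= snd (proj1_sig p) / 2 /\
    norm (minus (fst (proj1_sig p')) (fst (proj1_sig p))) + snd (proj1_sig p')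
      <= snd (proj1_sig p) /\
    exists i, forall z, norm (minus z (fst (proj1_sig p'))) <= snd (proj1_sig p') ->
      INR n <= norm (l i z)).
  { intros [n [[c r] Hr]]; simpl in *.
    destruct (unbounded_on_smaller_ball l Hlin Hunb (INR n) c r Hr)
      as [i [c' [r' [[Hr' Hhalf] [Hin Hbig]]]]].
    exists (exist _ (c', r') Hr'); simpl; eauto. }
  apply functional_choice in Hstep; destruct Hstep as [next Hnext].
  pose (b := fix b n : ball :=
    match n with
    | O => exist _ (zero, 1) Rlt_0_1
    | S n => next (n, b n)
    end).
  destruct (nested_balls (fun n => fst (proj1_sig (b n)))
              (fun n => snd (proj1_sig (b n)))) as [x Hx].
  - intros n; exact (proj2_sig (b n)).
  - intros n; exact (proj1 (Hnext (n, b n))).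
  - intros n; exact (proj1 (proj2 (Hnext (n, b n)))).
  - destruct (Hpt x) as [M HM].
    destruct (nfloor_ex (Rabs M)) as [n [_ Hn]]; [apply Rabs_pos|].
    destruct (proj2 (proj2 (Hnext (S n, b (S n))))) as [i Hi].
    specialize (Hi x (Hx (S (S n)))); specialize (HM i).
    rewrite S_INR in Hi; pose proof (Rle_abs M); lra.
Qed.

End UniformBoundedness.

(** * Strongly continuous semigroups on a real Banach space *)

Record semigroup {V : CompleteNormedModule R_AbsRing} (T : R -> V -> V) := {
  sg_linear : forall t, 0 <= t -> is_linear (T t);
  sg_zero : forall x, T 0 x = x;
  sg_add : forall s t x, 0 <= s -> 0 <= t -> T (s + t) x = T s (T t x);
  sg_right : forall x, filterlim (fun t => T t x) (at_right 0) (locally x)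
}.

Section Semigroup.

Context {V : CompleteNormedModule R_AbsRing} (T : R -> V -> V).
Hypothesis HT : semigroup T.

Lemma sg_near_0 x eta : 0 < eta -> exists delta, 0 < delta /\
  forall t, 0 <= t < delta -> norm (minus (T t x) x) < eta.
Proof.
  intros Heta.
  destruct (at_right_0_norm_lt (fun t => T t x) x (sg_right _ HT x) eta Heta)
    as [d [Hd H]].
  exists d; split; [exact Hd|]; intros t [[Ht| <-] Htd]; [now apply H|].
  rewrite (sg_zero _ HT), norm_minus_self; exact Heta.
Qed.

(** Otherwise there are times [t n] tending to [0] at which the operators are
    not uniformly bounded, although [T (t n) x] converges for each [x]. *)
Lemma sg_bounded_near_0 : exists delta M, 0 < delta /\ 1 <= M /\
  forall t, 0 <= t <= delta -> forall x, norm (T t x) <= M * norm x.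
Proof.
  apply NNPP; intros Hno.
  assert (Hbad : forall n : nat, exists t, 0 <= t <= / (INR n + 1) /\
            exists x, INR n * norm x < norm (T t x)).
  { intros n; apply NNPP; intros H; apply Hno.
    pose proof (pos_INR n).
    exists (/ (INR n + 1)), (INR n + 1); split; [apply Rinv_0_lt_compat; lra|].
    split; [lra|]; intros t Ht x; apply Rnot_lt_le; intros Hlt; apply H.
    exists t; split; [exact Ht|]; exists x.
    pose proof (norm_ge_0 x); lra. }
  apply functional_choice in Hbad; destruct Hbad as [t Ht].
  destruct (uniform_boundedness (fun n => T (t n))) as [M HM].
  - intros n; apply (sg_linear _ HT), (Ht n).
  - intros x.
    enough (Hlim : filterlim (fun n => T (t n) x) eventually (locally x)).
    { destruct (filterlim_bounded (fun n => T (t n) x) (ex_intro _ x Hlim)) as [M HM].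
      now exists M. }
    apply filterlim_norm_le; intros eta Heta.
    destruct (sg_near_0 x eta Heta) as [d [Hd H]].
    destruct (nfloor_ex (/ d)) as [N [_ HN]];
      [now apply Rlt_le, Rinv_0_lt_compat|].
    exists N; intros n Hn; apply H.
    destruct (proj1 (Ht n)) as [Ht0 Ht1]; split; [exact Ht0|].
    apply Rle_lt_trans with (1 := Ht1).
    rewrite <- (Rinv_inv d); apply Rinv_lt_contravar.
    + apply Rmult_lt_0_compat; [now apply Rinv_0_lt_compat|].
      pose proof (pos_INR n); lra.
    + apply le_INR in Hn; lra.
  - destruct (nfloor_ex (Rabs M)) as [n [_ Hn]]; [apply Rabs_pos|].
    destruct (proj2 (Ht (S n))) as [x Hx].
    specialize (HM (S n) x); simpl in HM.
    assert (M * norm x <= INR (S n) * norm x).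
    { apply Rmult_le_compat_r; [apply norm_ge_0|].
      rewrite S_INR; pose proof (Rle_abs M); lra. }
    lra.
Qed.

Lemma sg_bounded tau : exists M, 1 <= M /\
  forall t, 0 <= t <= tau -> forall x, norm (T t x) <= M * norm x.
Proof.
  destruct sg_bounded_near_0 as [d [M [Hd [HM Hb]]]].
  assert (Hn : forall n t, 0 <= t <= INR n * d -> forall x,
            norm (T t x) <= M ^ n * norm x).
  { induction n as [|n IH]; intros t Ht x.
    - simpl in *; replace t with 0 by lra; rewrite (sg_zero _ HT); lra.
    - rewrite S_INR in Ht; simpl.
      assert (Hmin : 0 <= Rmin t d <= d)
        by (split; [apply Rmin_glb; lra|apply Rmin_r]).
      assert (Hrest : 0 <= t - Rmin t d <= INR n * d).
      { split; [pose proof (Rmin_l t d); lra|].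
        unfold Rmin; destruct (Rle_dec t d);
          [|lra]. replace (t - t) with 0 by ring.
        apply Rmult_le_pos; [apply pos_INR|lra]. }
      replace t with (Rmin t d + (t - Rmin t d)) by ring.
      rewrite (sg_add _ HT) by lra.
      apply Rle_trans with (1 := Hb _ Hmin _).
      rewrite Rmult_assoc; apply Rmult_le_compat_l; [lra|].
      now apply IH. }
  destruct (nfloor_ex (Rabs tau / d)) as [n [_ HN]].
  { apply Rdiv_le_0_compat; [apply Rabs_pos|exact Hd]. }
  exists (M ^ S n); split; [now apply pow_R1_Rle|].
  intros t Ht; apply Hn; split; [lra|].
  apply Rmult_lt_compat_r with (r := d) in HN; [|exact Hd].
  replace (Rabs tau / d * d) with (Rabs tau) in HN by (field; lra).
  rewrite S_INR; pose proof (Rle_abs tau); lra.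
Qed.

(** The values of [T] at negative times are arbitrary; clamping the time at [0]
    makes the integrands below continuous on the whole line. *)
Lemma sg_continuous (a : R -> R) (g : R -> V) (s : R) :
  continuous a s -> continuous g s ->
  continuous (fun s => T (Rmax 0 (a s)) (g s)) s.
Proof.
  intros Ha Hg.
  destruct (sg_bounded (Rmax 0 (a s) + 1)) as [M [HM Hb]].
  apply continuous_norm_lt; intros eta Heta.
  destruct (sg_near_0 (g s) (eta / (2 * M))) as [d1 [Hd1 H1]].
  { apply Rdiv_lt_0_compat; lra. }
  destruct (proj1 (continuous_norm_lt g s) Hg (eta / (2 * M))) as [d2 [Hd2 H2]].
  { apply Rdiv_lt_0_compat; lra. }
  destruct (proj1 (continuous_norm_lt (V := R_CompleteNormedModule) a s) Ha (Rmin 1 d1))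
    as [d3 [Hd3 H3]]; [apply Rmin_pos; lra|].
  exists (Rmin d2 d3); split; [apply Rmin_pos; lra|].
  intros t Ht.
  specialize (H2 t (Rlt_le_trans _ _ _ Ht (Rmin_l _ _))).
  specialize (H3 t (Rlt_le_trans _ _ _ Ht (Rmin_r _ _))).
  change (Rabs (a t - a s) < Rmin 1 d1) in H3.
  pose proof (Rlt_le_trans _ _ _ H3 (Rmin_l _ _)) as H31.
  pose proof (Rlt_le_trans _ _ _ H3 (Rmin_r _ _)) as H3d.
  assert (Hclip : Rabs (Rmax 0 (a t) - Rmax 0 (a s)) <= Rabs (a t - a s)).
  { unfold Rmax; destruct (Rle_dec 0 (a t)), (Rle_dec 0 (a s));
      unfold Rabs; repeat destruct Rcase_abs; lra. }
  pose proof (Rmax_l 0 (a t)) as Hu0; pose proof (Rmax_l 0 (a s)) as Hv0.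
  set (u := Rmax 0 (a t)) in *; set (v := Rmax 0 (a s)) in *.
  assert (Huv : u <= v + 1 /\ Rabs (u - v) < d1).
  { split; [|lra]; pose proof (Rle_abs (u - v)); lra. }
  assert (Hmove : norm (minus (T u (g s)) (T v (g s))) <= M * (eta / (2 * M))).
  { assert (Hsym : forall p q, 0 <= p -> p <= q -> q <= v + 1 -> q - p < d1 ->
      norm (minus (T q (g s)) (T p (g s))) <= M * (eta / (2 * M))).
    { intros p q Hp Hpq Hq Hd.
      replace q with (p + (q - p)) by ring.
      rewrite (sg_add _ HT) by lra.
      rewrite <- (linear_minus _ _ _ (sg_linear _ HT p Hp)).
      apply Rle_trans with (1 := Hb p ltac:(lra) _).
      apply Rmult_le_compat_l; [lra|].
      apply Rlt_le, H1; lra. }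
    destruct Huv as [Huv1 Huv2].
    destruct (Rle_dec v u) as [Hle|Hle].
    - apply Hsym; try lra; rewrite Rabs_pos_eq in Huv2; lra.
    - rewrite norm_minus_sym; apply Hsym; try lra.
      rewrite Rabs_minus_sym, Rabs_pos_eq in Huv2; lra. }
  assert (Hval : norm (T u (minus (g t) (g s))) < M * (eta / (2 * M))).
  { apply Rle_lt_trans with (1 := Hb u ltac:(lra) _).
    apply Rmult_lt_compat_l; lra. }
  replace (M * (eta / (2 * M))) with (eta / 2) in * by (field; lra).
  apply Rle_lt_trans with (norm (T u (minus (g t) (g s)))
    + norm (minus (T u (g s)) (T v (g s)))); [|lra].
  apply norm_le_plus; rewrite (linear_minus _ _ _ (sg_linear _ HT u Hu0)); vec V.
Qed.

Lemma sg_orbit_continuous v s : continuous (fun s => T (Rmax 0 s) v) s.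
Proof.
  apply (sg_continuous (fun s => s) (fun _ => v));
    [apply continuous_id|apply continuous_const].
Qed.

End Semigroup.

(** * Vector-valued integrals *)

Section Integrals.

Context {V : CompleteNormedModule R_AbsRing}.

Lemma Riemann_sum_linear (l : V -> V) (f : R -> V) ptd :
  is_linear l -> Riemann_sum (fun s => l (f s)) ptd = l (Riemann_sum f ptd).
Proof.
  intros Hl; induction ptd as [x0|h ptd IH] using SF_cons_ind.
  - replace (Riemann_sum f (SF_nil x0)) with (scal 0 (zero : V))
      by exact (scal_zero_l _).
    rewrite (linear_scal_R l 0 zero Hl); symmetry; exact (scal_zero_l _).
  - rewrite !Riemann_sum_cons, IH.
    rewrite <- (linear_scal_R l _ _ Hl : l (scal (SF_h ptd - fst h) (f (snd h))) = _).
    symmetry; exact (linear_plus_R l _ _ Hl).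
Qed.

(** A bounded linear map commutes with Riemann sums and passes to their limit. *)
Lemma is_RInt_linear (l : V -> V) (f : R -> V) a b I :
  is_linear l -> is_RInt f a b I -> is_RInt (fun s => l (f s)) a b (l I).
Proof.
  intros Hl HI; unfold is_RInt in *.
  apply filterlim_ext with
    (fun ptd => l (scal (sign (b - a)) (Riemann_sum f ptd))).
  { intros ptd; rewrite Riemann_sum_linear by exact Hl.
    exact (linear_scal_R l _ _ Hl). }
  apply filterlim_comp with (1 := HI).
  exact (linear_cont l I Hl).
Qed.

Lemma ex_RInt_cont (f : R -> V) a b :
  (forall s, continuous f s) -> ex_RInt f a b.
Proof. intros Hf; apply ex_RInt_continuous; intros s _; apply Hf. Qed.

Lemma RInt_linear (l : V -> V) (f : R -> V) a b :
  is_linear l -> ex_RInt f a b -> RInt (fun s => l (f s)) a b = l (RInt f a b).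
Proof.
  intros Hl Hf; apply is_RInt_unique, is_RInt_linear; [exact Hl|].
  now apply RInt_correct.
Qed.

Lemma norm_RInt_le_RInt (f : R -> V) (g : R -> R) a b :
  a <= b -> ex_RInt f a b -> ex_RInt g a b ->
  (forall s, a <= s <= b -> norm (f s) <= g s) ->
  norm (RInt f a b) <= RInt g a b.
Proof.
  intros Hab Hf Hg H.
  exact (norm_RInt_le f g a b _ _ Hab H (RInt_correct f a b Hf)
           (RInt_correct (V := R_CompleteNormedModule) g a b Hg)).
Qed.

Lemma norm_RInt_le_length (f : R -> V) a b M :
  a <= b -> ex_RInt f a b -> (forall s, a <= s <= b -> norm (f s) <= M) ->
  norm (RInt f a b) <= (b - a) * M.
Proof.
  intros Hab Hf H.
  exact (norm_RInt_le_const f a b _ M Hab H (RInt_correct f a b Hf)).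
Qed.

Lemma norm_continuous (f : R -> V) s :
  continuous f s -> continuous (fun s => norm (f s)) s.
Proof.
  intros Hf; apply (filterlim_comp _ _ _ f norm _ _ _ Hf).
  exact (filterlim_norm (f s)).
Qed.

Lemma RInt_shift (f : R -> V) c a b :
  (forall s, continuous f s) -> RInt (fun s => f (c + s)) a b = RInt f (c + a) (c + b).
Proof.
  intros Hf.
  replace (c + a) with (1 * a + c) by ring.
  replace (c + b) with (1 * b + c) by ring.
  rewrite <- RInt_comp_lin by now apply ex_RInt_cont.
  apply RInt_ext; intros s _.
  replace (1 * s + c) with (c + s) by ring.
  symmetry; exact (scal_one _).
Qed.

Lemma RInt_add (f : R -> V) a b c :
  (forall s, continuous f s) -> RInt f a c = plus (RInt f a b) (RInt f b c).
Proof.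
  intros Hf; symmetry; apply RInt_Chasles; now apply ex_RInt_cont.
Qed.

(** A right derivative suffices: the times up to which the inequality (with a
    slightly larger constant) holds form a closed set that can be continued to
    the right. *)
Lemma mean_value_right (g : R -> V) a b K :
  a <= b -> (forall s, continuous g s) ->
  (forall s, a <= s < b -> forall eta, 0 < eta -> exists delta, 0 < delta /\
    forall t, 0 < t < delta -> s + t <= b ->
      norm (minus (g (s + t)) (g s)) <= (K + eta) * t) ->
  norm (minus (g b) (g a)) <= K * (b - a).
Proof.
  intros Hab Hg Hd.
  assert (Heta : forall eta, 0 < eta -> norm (minus (g b) (g a)) <= (K + eta) * (b - a)).
  { intros eta Heta.
    set (E := fun s => a <= s <= b /\ norm (minus (g s) (g a)) <= (K + eta) * (s - a)).
    assert (Ea : E a).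
    { split; [lra|]; rewrite norm_minus_self; lra. }
    destruct (completeness E) as [m [Hub Hlub]].
    { exists b; intros s [Hs _]; lra. }
    { now exists a. }
    assert (Hmb : a <= m <= b).
    { split; [now apply Hub|]; apply Hlub; intros s [Hs _]; lra. }
    assert (Em : E m).
    { split; [exact Hmb|]; apply Rnot_lt_le; intros Hlt.
      set (gap := norm (minus (g m) (g a)) - (K + eta) * (m - a)).
      assert (Hgap : 0 < gap) by (unfold gap; lra).
      destruct (proj1 (continuous_norm_lt g m) (Hg m) (gap / 2)) as [d [Hd0 Hc]]; [lra|].
      (* points of [E] accumulate at [m] from the left; [C] bounds the slope,
         which may be negative *)
      set (C := Rabs (K + eta) + 1).
      assert (HC : 0 < C) by (unfold C; pose proof (Rabs_pos (K + eta)); lra).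
      assert (Hd' : 0 < Rmin d (gap / (2 * C))).
      { apply Rmin_pos; [exact Hd0|apply Rdiv_lt_0_compat; lra]. }
      assert (Hs : exists s, E s /\ m - Rmin d (gap / (2 * C)) < s).
      { apply NNPP; intros Hno.
        assert (m <= m - Rmin d (gap / (2 * C))); [|lra].
        apply Hlub; intros s Hs; apply Rnot_lt_le; intros H; apply Hno.
        now exists s. }
      destruct Hs as [s [[Hs Hsle] Hms]].
      assert (Hsm : s <= m) by (apply Hub; now split).
      pose proof (Rmin_l d (gap / (2 * C))); pose proof (Rmin_r d (gap / (2 * C))).
      specialize (Hc s); rewrite Rabs_minus_sym, Rabs_pos_eq in Hc by lra.
      specialize (Hc ltac:(lra)).
      assert (Hn : norm (minus (g m) (g a)) <=
                norm (minus (g m) (g s)) + norm (minus (g s) (g a)))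
        by (apply norm_le_plus; vec V).
      rewrite (norm_minus_sym (g m) (g s)) in Hn.
      assert (Hslope : - ((K + eta) * (m - s)) <= C * (gap / (2 * C))).
      { apply Rle_trans with (C * (m - s)).
        - rewrite Ropp_mult_distr_l; apply Rmult_le_compat_r; [lra|].
          unfold C; pose proof (Rle_abs (- (K + eta))).
          rewrite Rabs_Ropp in H1; lra.
        - apply Rmult_le_compat_l; lra. }
      replace (C * (gap / (2 * C))) with (gap / 2) in Hslope by (field; lra).
      unfold gap in *; lra. }
    destruct (Req_dec m b) as [<-|Hne]; [apply Em|].
    destruct (Hd m ltac:(lra) eta Heta) as [d [Hd0 H]].
    set (t := Rmin (d / 2) (b - m)).
    assert (Ht : 0 < t) by (apply Rmin_pos; lra).
    pose proof (Rmin_l (d / 2) (b - m)); pose proof (Rmin_r (d / 2) (b - m)).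
    fold t in H0, H1.
    assert (m + t <= m); [|lra].
    apply Hub; split; [lra|].
    assert (Hn : norm (minus (g (m + t)) (g a)) <=
              norm (minus (g (m + t)) (g m)) + norm (minus (g m) (g a)))
      by (apply norm_le_plus; vec V).
    specialize (H t ltac:(lra) ltac:(lra)); destruct Em as [_ Em]; lra. }
  apply Rnot_lt_le; intros Hlt.
  set (gap := norm (minus (g b) (g a)) - K * (b - a)).
  assert (Hgap : 0 < gap) by (unfold gap; lra).
  assert (Hq : 0 < gap / (2 * (b - a + 1))) by (apply Rdiv_lt_0_compat; lra).
  specialize (Heta _ Hq).
  assert (gap / (2 * (b - a + 1)) * (b - a) <= gap / 2).
  { apply Rle_trans with (gap / (2 * (b - a + 1)) * (b - a + 1)).
    - apply Rmult_le_compat_l; lra.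
    - right; field; lra. }
  unfold gap in *; lra.
Qed.

End Integrals.

(** * Integrated orbits and perturbed semigroups *)

Section OrbitIntegral.

Context {V : CompleteNormedModule R_AbsRing} (T : R -> V -> V).
Hypothesis HT : semigroup T.

Definition orbit_integral (tau : R) (v : V) : V := RInt (fun s => T s v) 0 tau.

Lemma orbit_integral_clamp tau v : 0 <= tau ->
  orbit_integral tau v = RInt (fun s => T (Rmax 0 s) v) 0 tau.
Proof.
  intros Htau; apply RInt_ext; intros s Hs.
  rewrite Rmin_left, Rmax_right in Hs by lra; now rewrite Rmax_right by lra.
Qed.

Lemma orbit_integral_minus tau (v w : V) : 0 <= tau ->
  orbit_integral tau (minus v w) = minus (orbit_integral tau v) (orbit_integral tau w).
Proof.
  intros Htau; rewrite !orbit_integral_clamp by exact Htau.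
  rewrite <- (RInt_minus (V := V)) by (apply ex_RInt_cont, sg_orbit_continuous, HT).
  apply RInt_ext; intros s _.
  apply (linear_minus (T (Rmax 0 s))), (sg_linear _ HT), Rmax_l.
Qed.

Lemma orbit_integral_scal tau r (v : V) : 0 <= tau ->
  orbit_integral tau (scal r v) = scal r (orbit_integral tau v).
Proof.
  intros Htau; rewrite !orbit_integral_clamp by exact Htau.
  rewrite <- (RInt_scal (V := V)) by (apply ex_RInt_cont, sg_orbit_continuous, HT).
  apply RInt_ext; intros s _.
  apply (linear_scal_R (T (Rmax 0 s))), (sg_linear _ HT), Rmax_l.
Qed.

Lemma orbit_integral_bounded tau M v : 0 <= tau ->
  (forall t, 0 <= t <= tau -> forall x, norm (T t x) <= M * norm x) ->
  norm (orbit_integral tau v) <= tau * (M * norm v).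
Proof.
  intros Htau HM; rewrite orbit_integral_clamp by exact Htau.
  rewrite <- (Rminus_0_r tau) at 2.
  apply norm_RInt_le_length; [exact Htau| |].
  - apply ex_RInt_cont, sg_orbit_continuous, HT.
  - intros s Hs; rewrite Rmax_right by lra; now apply HM.
Qed.

(** The function [orbit_integral] is a cocycle over [T]; difference quotients of
    integrated orbits can therefore be computed without differentiating an
    integral. *)
Lemma orbit_integral_shift r tau v : 0 <= r -> 0 <= tau ->
  T r (orbit_integral tau v) = minus (orbit_integral (r + tau) v) (orbit_integral r v).
Proof.
  intros Hr Htau; rewrite !orbit_integral_clamp by lra.
  rewrite <- RInt_linear;
    [|now apply (sg_linear _ HT)|apply ex_RInt_cont, sg_orbit_continuous, HT].
  rewrite (RInt_ext (V := V) _ (fun s => T (Rmax 0 (r + s)) v)).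
  - rewrite (RInt_shift (fun s => T (Rmax 0 s) v)) by apply sg_orbit_continuous, HT.
    rewrite (RInt_add _ 0 r (r + tau)) by apply sg_orbit_continuous, HT.
    rewrite Rplus_0_r; vec V.
  - intros s Hs; rewrite Rmin_left, Rmax_right in Hs by lra.
    rewrite !Rmax_right by lra; symmetry; apply (sg_add _ HT); lra.
Qed.

Lemma orbit_integral_near_0 v eta : 0 < eta -> exists delta, 0 < delta /\
  forall t, 0 <= t < delta ->
    norm (minus (orbit_integral t v) (scal t v)) <= eta * t.
Proof.
  intros Heta; destruct (sg_near_0 _ HT v eta Heta) as [d [Hd H]].
  exists d; split; [exact Hd|]; intros t Ht.
  assert (Hc : forall s, continuous (fun s => minus (T (Rmax 0 s) v) v) s).
  { intros s; apply (continuous_minus (V := V));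
      [apply sg_orbit_continuous, HT|apply continuous_const]. }
  assert (HI : minus (orbit_integral t v) (scal t v) =
            RInt (fun s => minus (T (Rmax 0 s) v) v) 0 t).
  { rewrite orbit_integral_clamp by lra.
    rewrite (RInt_minus (V := V));
      [|apply ex_RInt_cont, sg_orbit_continuous, HT|apply ex_RInt_const].
    rewrite RInt_const, Rminus_0_r; reflexivity. }
  rewrite HI, Rmult_comm; rewrite <- (Rminus_0_r t) at 2.
  apply norm_RInt_le_length; [lra|now apply ex_RInt_cont|].
  intros s Hs; rewrite Rmax_right by lra; apply Rlt_le, H; lra.
Qed.

Lemma orbit_integral_continuous (a : R -> R) v s :
  (forall s, 0 <= a s) -> continuous a s ->
  continuous (fun s => orbit_integral (a s) v) s.
Proof.
  intros Ha Hc.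
  apply continuous_ext with (fun s => RInt (fun s => T (Rmax 0 s) v) 0 (a s)).
  { intros t; symmetry; apply orbit_integral_clamp, Ha. }
  apply (continuous_comp a (fun b => RInt (fun s => T (Rmax 0 s) v) 0 b)); [exact Hc|].
  apply (ex_derive_continuous (V := V)).
  exists (T (Rmax 0 (a s)) v).
  apply (is_derive_RInt (fun s => T (Rmax 0 s) v) _ 0).
  - exists (mkposreal 1 Rlt_0_1); intros b _.
    apply RInt_correct, ex_RInt_cont, sg_orbit_continuous, HT.
  - apply sg_orbit_continuous, HT.
Qed.

End OrbitIntegral.

Section RightDerivative.

Context {V : CompleteNormedModule R_AbsRing} (T : R -> V -> V).
Hypothesis HT : semigroup T.

(** [z] lies in the domain of the generator of [T], with value [y]. *)
Definition right_derivative (z y : V) : Prop :=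
  forall eta, 0 < eta -> exists delta, 0 < delta /\
    forall t, 0 < t < delta ->
      norm (minus (minus (T t z) z) (scal t y)) <= eta * t.

Lemma norm_quotient (u y : V) t : 0 < t ->
  norm (minus u (scal t y)) = t * norm (minus (scal (/ t) u) y).
Proof.
  intros Ht.
  assert (E : minus u (scal t y) = scal t (minus (scal (/ t) u) y)) by vec V.
  now rewrite E, norm_scal_eq, Rabs_pos_eq by lra.
Qed.

Lemma right_derivative_iff (z y : V) :
  right_derivative z y <->
  filterlim (fun t => scal (/ t) (minus (T t z) z)) (at_right 0) (locally y).
Proof.
  split.
  - intros H; apply filterlim_norm_le; intros eta Heta.
    destruct (H (eta / 2)) as [d [Hd H1]]; [lra|].
    exists (mkposreal d Hd); intros t Ht Ht0.
    change (Rabs (t - 0) < d) in Ht; rewrite Rminus_0_r, Rabs_pos_eq in Ht by lra.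
    specialize (H1 t (conj Ht0 Ht)); rewrite norm_quotient in H1 by exact Ht0.
    rewrite Rmult_comm in H1; apply Rmult_le_reg_r in H1; [|exact Ht0].
    apply Rle_lt_trans with (1 := H1); lra.
  - intros H eta Heta.
    destruct (at_right_0_norm_lt _ _ H eta Heta) as [d [Hd H1]].
    exists d; split; [exact Hd|]; intros t Ht.
    rewrite norm_quotient by lra; rewrite Rmult_comm.
    apply Rmult_le_compat_r; [lra|]; apply Rlt_le, H1, Ht.
Qed.

(** The domain of the generator is invariant, because [T s] commutes with [T t]. *)
Lemma right_derivative_orbit (z y : V) s : 0 <= s ->
  right_derivative z y -> right_derivative (T s z) (T s y).
Proof.
  intros Hs H eta Heta.
  destruct (sg_bounded _ HT s) as [M [HM Hb]].
  destruct (H (eta / M)) as [d [Hd H1]]; [apply Rdiv_lt_0_compat; lra|].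
  exists d; split; [exact Hd|]; intros t Ht.
  assert (E : minus (minus (T t (T s z)) (T s z)) (scal t (T s y))
            = T s (minus (minus (T t z) z) (scal t y))).
  { pose proof (sg_linear _ HT s Hs) as Hl.
    rewrite <- (sg_add _ HT), Rplus_comm, (sg_add _ HT) by lra.
    rewrite !(linear_minus _ _ _ Hl), (linear_scal_R _ _ _ Hl); reflexivity. }
  rewrite E; apply Rle_trans with (1 := Hb s ltac:(lra) _).
  replace (eta * t) with (M * (eta / M * t)) by (field; lra).
  apply Rmult_le_compat_l; [lra|now apply H1].
Qed.

(** The increment of [orbit_integral T r x] over a time [t] is
    [T r (orbit_integral T t x) - orbit_integral T t x], and
    [orbit_integral T t x] is asymptotic to [t x]. *)
Lemma right_derivative_integral (x : V) r : 0 <= r ->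
  right_derivative (orbit_integral T r x) (minus (T r x) x).
Proof.
  intros Hr eta Heta.
  destruct (sg_bounded _ HT r) as [M [HM Hb]].
  destruct (orbit_integral_near_0 T HT x (eta / (2 * M))) as [d [Hd H]].
  { apply Rdiv_lt_0_compat; lra. }
  exists d; split; [exact Hd|]; intros t Ht.
  pose proof (sg_linear _ HT r Hr) as Hl.
  pose proof (orbit_integral_shift T HT r t x Hr ltac:(lra)) as E1.
  specialize (H t ltac:(lra)).
  apply Rle_trans with
    (norm (T r (minus (orbit_integral T t x) (scal t x)))
       + norm (opp (minus (orbit_integral T t x) (scal t x)))).
  - apply norm_le_plus.
    rewrite orbit_integral_shift by (try exact HT; lra).
    rewrite (linear_minus _ _ _ Hl), (linear_scal_R _ _ _ Hl), E1.
    rewrite (Rplus_comm t r); vec V.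
  - rewrite norm_opp_R.
    pose proof (Hb r ltac:(lra) (minus (orbit_integral T t x) (scal t x))) as H2.
    pose proof (Rmult_le_compat_l M _ _ ltac:(lra) H) as H3.
    replace (M * (eta / (2 * M) * t)) with (eta / 2 * t) in H3 by (field; lra).
    assert (eta / (2 * M) * t <= eta / 2 * t).
    { apply Rmult_le_compat_r; [lra|].
      apply Rmult_le_compat_l; [lra|]; apply Rinv_le_contravar; lra. }
    lra.
Qed.

End RightDerivative.

Section Perturbation.

Context {V : CompleteNormedModule R_AbsRing} (T Q : R -> V -> V) (P : V -> V).
Hypothesis HT : semigroup T.
Hypothesis HQ : semigroup Q.
Hypothesis HP : is_linear P.
Hypothesis Hgen : forall z y, right_derivative Q z y ->
  right_derivative T z (minus y (P z)).

(** The operator [Delta_op] of the loop, with the composite [P] for [B F]. *)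
Definition sampled_map (tau : R) (x : V) : V := plus (T tau x) (orbit_integral T tau (P x)).

Lemma sampled_map_minus tau (x y : V) : 0 <= tau ->
  sampled_map tau (minus x y) = minus (sampled_map tau x) (sampled_map tau y).
Proof.
  intros Htau; unfold sampled_map.
  rewrite (linear_minus _ _ _ (sg_linear _ HT tau Htau)), (linear_minus _ _ _ HP).
  rewrite (orbit_integral_minus T HT) by exact Htau; vec V.
Qed.

Lemma sampled_map_scal tau r (x : V) : 0 <= tau ->
  sampled_map tau (scal r x) = scal r (sampled_map tau x).
Proof.
  intros Htau; unfold sampled_map.
  rewrite (linear_scal_R _ _ _ (sg_linear _ HT tau Htau)), (linear_scal_R _ _ _ HP).
  rewrite (orbit_integral_scal T HT) by exact Htau; vec V.
Qed.

Lemma sampled_map_bounded tau : exists M, 0 <= M /\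
  forall t, 0 <= t <= tau -> forall x, norm (sampled_map t x) <= M * norm x.
Proof.
  destruct (sg_bounded _ HT tau) as [M [HM Hb]].
  destruct (linear_norm _ HP) as [K [HK HPK]].
  exists (M + Rabs tau * (M * K)); split.
  { pose proof (Rabs_pos tau).
    assert (0 <= Rabs tau * (M * K)) by (repeat apply Rmult_le_pos; lra); lra. }
  intros t Ht x; unfold sampled_map.
  apply Rle_trans with (1 := norm_triangle_R _ _).
  rewrite Rmult_plus_distr_r; apply Rplus_le_compat; [now apply Hb|].
  apply Rle_trans with (t * (M * norm (P x))).
  - apply orbit_integral_bounded; [exact HT|lra|]; intros; apply Hb; lra.
  - rewrite !Rmult_assoc; apply Rmult_le_compat; [lra| | |].
    + apply Rmult_le_pos; [lra|apply norm_ge_0].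
    + pose proof (Rle_abs tau); lra.
    + apply Rmult_le_compat_l; [lra|apply HPK].
Qed.

(** Along [s |-> T (h - s) (Q s x) + int_0^(h-s) T P x], which joins the sampled
    map at [s = 0] to [Q h x] at [s = h], the unbounded parts of the two
    generators cancel and the right derivative is [T (h - s) P (Q s x - x)]. *)
Lemma sampled_map_near_domain h w (x y : V) : 0 <= h ->
  (forall s, 0 <= s <= h -> norm (T (h - s) (P (minus x (Q s x)))) <= w * norm x) ->
  right_derivative Q x y ->
  norm (minus (Q h x) (sampled_map h x)) <= w * norm x * h.
Proof.
  intros Hh Hw Hx.
  set (path := fun s => plus (T (Rmax 0 (h - s)) (Q (Rmax 0 s) x))
                             (orbit_integral T (Rmax 0 (h - s)) (P x))).
  assert (E0 : path 0 = sampled_map h x).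
  { unfold path; rewrite Rminus_0_r, !Rmax_right, (sg_zero _ HQ) by lra; reflexivity. }
  assert (Eh : path h = Q h x).
  { unfold path; replace (h - h) with 0 by ring.
    rewrite !Rmax_right, (sg_zero _ HT) by lra.
    replace (orbit_integral T 0 (P x)) with (zero : V)
      by (symmetry; apply (RInt_point (V := V))).
    vec V. }
  rewrite <- E0, <- Eh; rewrite <- (Rminus_0_r h) at 2.
  assert (Hcont : forall s, continuous (fun s => h - s) s).
  { intros s; apply (continuous_minus (V := R_NormedModule));
      [apply continuous_const|apply continuous_id]. }
  assert (Hmax : forall s, continuous (fun s => Rmax 0 (h - s)) s).
  { intros s.
    apply (continuous_ext (fun s => (h - s + Rabs (h - s)) / 2)).
    { intros t; unfold Rmax, Rabs; destruct Rle_dec, Rcase_abs; simpl; lra. }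
    apply (continuous_mult (K := R_AbsRing) (fun s => h - s + Rabs (h - s)) (fun _ => / 2));
      [|apply continuous_const].
    apply (continuous_plus (V := R_NormedModule) (fun s => h - s));
      [apply Hcont|].
    apply (continuous_comp (fun s => h - s) Rabs); [apply Hcont|].
    apply (filterlim_norm (V := R_NormedModule)). }
  apply mean_value_right; [exact Hh| |].
  { intros s; apply (continuous_plus (V := V)).
    - apply (sg_continuous T HT (fun s => h - s) (fun s => Q (Rmax 0 s) x)); [apply Hcont|].
      apply sg_orbit_continuous, HQ.
    - apply (orbit_integral_continuous T HT (fun s => Rmax 0 (h - s)));
        [intros; apply Rmax_l|apply Hmax]. }
  intros s Hs eta Heta.
  destruct (sg_bounded _ HT h) as [M [HM Hb]].
  set (z := Q s x).
  pose proof (right_derivative_orbit Q HQ x y s (proj1 Hs) Hx) as HQz; fold z in HQz.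
  pose proof (Hgen _ _ HQz) as HTz.
  assert (He : 0 < eta / (4 * M)) by (apply Rdiv_lt_0_compat; lra).
  destruct (HQz _ He) as [d1 [Hd1 H1]].
  destruct (HTz _ He) as [d2 [Hd2 H2]].
  destruct (orbit_integral_near_0 T HT (P x) _ He) as [d3 [Hd3 H3]].
  set (u := P (minus x z)).
  destruct (proj1 (continuous_norm_lt _ _) (sg_orbit_continuous T HT u (h - s)) (eta / 4))
    as [d4 [Hd4 H4]]; [lra|].
  exists (Rmin (Rmin d1 d2) (Rmin d3 d4)); split; [repeat apply Rmin_pos; lra|].
  intros t Ht Hst.
  assert (Htd : t < d1 /\ t < d2 /\ t < d3 /\ t < d4).
  { pose proof (Rmin_l (Rmin d1 d2) (Rmin d3 d4)); pose proof (Rmin_r (Rmin d1 d2) (Rmin d3 d4)).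
    pose proof (Rmin_l d1 d2); pose proof (Rmin_r d1 d2).
    pose proof (Rmin_l d3 d4); pose proof (Rmin_r d3 d4); lra. }
  specialize (H1 t ltac:(lra)); specialize (H2 t ltac:(lra));
    specialize (H3 t ltac:(lra)).
  set (p := h - (s + t)).
  assert (Hp : 0 <= p <= h) by (unfold p; lra).
  specialize (H4 p); rewrite !Rmax_right in H4 by lra.
  replace (p - (h - s)) with (- t) in H4 by (unfold p; ring).
  rewrite Rabs_Ropp, Rabs_pos_eq in H4 by lra; specialize (H4 ltac:(lra)).
  assert (Hu : norm (T p u) <= w * norm x + eta / 4).
  { pose proof (norm_le_minus (T p u) (T (h - s) u)).
    specialize (Hw s ltac:(lra)); fold z u in Hw; lra. }
  pose proof (sg_linear _ HT p (proj1 Hp)) as Hl.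
  set (eQ := minus (minus (Q t z) z) (scal t (Q s y))) in *.
  set (eT := minus (minus (T t z) z) (scal t (minus (Q s y) (P z)))) in *.
  set (eS := minus (orbit_integral T t (P x)) (scal t (P x))) in *.
  assert (E : minus (path (s + t)) (path s) =
            plus (T p (minus (minus eQ eT) eS)) (scal (- t) (T p u))).
  { unfold path; fold p.
    replace (h - s) with (p + t) by (unfold p; ring).
    rewrite !Rmax_right by (unfold p; lra).
    rewrite (sg_add _ HT) by lra.
    replace (s + t) with (t + s) by ring; rewrite (sg_add _ HQ) by lra; fold z.
    pose proof (orbit_integral_shift T HT p t (P x) (proj1 Hp) ltac:(lra)) as Hsh.
    unfold eQ, eT, eS, u.
    rewrite (linear_minus _ _ _ HP).
    rewrite !(linear_minus _ _ _ Hl), !(linear_scal_R _ _ _ Hl), Hsh,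
      !(linear_minus _ _ _ Hl).
    vec V. }
  assert (He3 : norm (minus (minus eQ eT) eS) <= 3 * (eta / (4 * M) * t)).
  { apply Rle_trans with (1 := norm_minus_le _ _).
    pose proof (norm_minus_le eQ eT); lra. }
  assert (Hfirst : norm (T p (minus (minus eQ eT) eS)) <= 3 * (eta / 4) * t).
  { apply Rle_trans with (1 := Hb p Hp _).
    apply (Rmult_le_compat_l M) in He3; [|lra].
    apply Rle_trans with (1 := He3); right; field; lra. }
  rewrite E; apply Rle_trans with (1 := norm_triangle_R _ _).
  rewrite norm_scal_eq, Rabs_Ropp, Rabs_pos_eq by lra.
  apply (Rmult_le_compat_l t) in Hu; [|lra]; lra.
Qed.

(** The domain of the generator is dense: it contains the integrated orbits
    [int_0^r Q x], which are asymptotic to [r x]. *)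
Lemma sampled_map_near h w : 0 <= h -> 0 <= w ->
  (forall s, 0 <= s <= h -> forall x, norm (T (h - s) (P (minus x (Q s x)))) <= w * norm x) ->
  forall x, norm (minus (Q h x) (sampled_map h x)) <= w * h * norm x.
Proof.
  intros Hh Hw0 Hw x.
  set (D := fun x => minus (Q h x) (sampled_map h x)).
  assert (HDm : forall a b, D (minus a b) = minus (D a) (D b)).
  { intros a b; unfold D.
    rewrite sampled_map_minus, (linear_minus _ _ _ (sg_linear _ HQ h Hh)) by exact Hh.
    vec V. }
  assert (HDs : forall r a, D (scal r a) = scal r (D a)).
  { intros r a; unfold D.
    rewrite sampled_map_scal, (linear_scal_R _ _ _ (sg_linear _ HQ h Hh)) by exact Hh.
    vec V. }
  assert (HDb : exists C, 0 <= C /\ forall a, norm (D a) <= C * norm a).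
  { destruct (sampled_map_bounded h) as [M1 [HM1 Hb1]].
    destruct (sg_bounded _ HQ h) as [M2 [HM2 Hb2]].
    exists (M2 + M1); split; [lra|]; intros a; unfold D.
    apply Rle_trans with (1 := norm_minus_le _ _).
    specialize (Hb1 h ltac:(lra) a); specialize (Hb2 h ltac:(lra) a); lra. }
  destruct HDb as [C [HC HDb]].
  change (norm (D x) <= w * h * norm x).
  apply Rnot_lt_le; intros Hlt.
  set (gap := norm (D x) - w * h * norm x).
  assert (Hwh : 0 <= w * h) by now apply Rmult_le_pos.
  set (eta := gap / (2 * (C + w * h + 1))).
  assert (Heta : 0 < eta) by (apply Rdiv_lt_0_compat; unfold gap; lra).
  destruct (orbit_integral_near_0 Q HQ x eta Heta) as [d [Hd H]].
  set (r := d / 2); assert (Hr : 0 < r) by (unfold r; lra).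
  specialize (H r ltac:(unfold r; lra)).
  set (y := orbit_integral Q r x) in *.
  assert (Hy : norm (D y) <= w * h * norm y).
  { replace (w * h * norm y) with (w * norm y * h) by ring.
    apply (sampled_map_near_domain h w y (minus (Q r x) x)); [exact Hh| |].
    - intros s Hs; now apply Hw.
    - apply right_derivative_integral; [exact HQ|lra]. }
  assert (Hrx : r * norm (D x) <= norm (D (minus y (scal r x))) + norm (D y)).
  { replace (r * norm (D x)) with (norm (scal r (D x)))
      by (rewrite norm_scal_eq, Rabs_pos_eq by lra; reflexivity).
    rewrite <- HDs, HDm, norm_minus_sym; apply norm_le_minus. }
  assert (Hny : norm y <= eta * r + r * norm x).
  { pose proof (norm_le_minus y (scal r x)) as Hle.
    rewrite norm_scal_eq, Rabs_pos_eq in Hle by lra; lra. }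
  pose proof (HDb (minus y (scal r x))) as HDe.
  apply (Rmult_le_compat_l C) in H; [|exact HC].
  apply (Rmult_le_compat_l (w * h)) in Hny; [|exact Hwh].
  assert (Hfin : r * norm (D x) <= r * ((C + w * h) * eta + w * h * norm x)) by lra.
  apply Rmult_le_reg_l in Hfin; [|exact Hr].
  assert ((C + w * h) * eta <= gap / 2).
  { apply Rle_trans with ((C + w * h + 1) * eta); [apply Rmult_le_compat_r; lra|].
    right; unfold eta; field; lra. }
  unfold gap in *; lra.
Qed.

End Perturbation.

(** * Mild solutions with a constant input *)

(** The derivative of [(a + c int_0^t v) e^(-c t)] is
    [c (v t - a - c int_0^t v) e^(-c t)], which is nonpositive. *)
Lemma gronwall (v : R -> R) a c tau : 0 <= tau -> 0 <= c ->
  (forall s, continuous v s) ->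
  (forall t, 0 <= t <= tau -> v t <= a + c * RInt v 0 t) ->
  a + c * RInt v 0 tau <= a * exp (c * tau).
Proof.
  intros Htau Hc Hv H.
  set (q := fun t => (a + c * RInt v 0 t) * exp (- (c * t))).
  set (dq := fun t => c * (v t - (a + c * RInt v 0 t)) * exp (- (c * t))).
  assert (Hd : forall t, is_derive q t (dq t)).
  { intros t.
    assert (HI : is_derive (fun t => RInt v 0 t) t (v t)).
    { apply (is_derive_RInt (V := R_NormedModule) v _ 0); [|apply Hv].
      exists (mkposreal 1 Rlt_0_1); intros b _.
      apply (RInt_correct (V := R_CompleteNormedModule)).
      apply (ex_RInt_cont (V := R_CompleteNormedModule)), Hv. }
    set (J := (fun t => RInt v 0 t) : R -> R).
    change (is_derive J t (v t)) in HI.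
    change (is_derive (fun t => (a + c * J t) * exp (- (c * t))) t
              (c * (v t - (a + c * J t)) * exp (- (c * t)))).
    clearbody J.
    auto_derive; [repeat split; now exists (v t)|].
    replace (Derive (fun t => J t) t) with (v t)
      by (symmetry; apply is_derive_unique, HI); ring. }
  assert (Hq : q tau <= q 0).
  { destruct (MVT_gen q 0 tau dq) as [t [Ht E]].
    - intros t _; apply Hd.
    - intros t _; apply continuity_pt_filterlim.
      apply (ex_derive_continuous q); exists (dq t); apply Hd.
    - rewrite Rmin_left, Rmax_right in Ht by lra.
      assert (dq t <= 0); [|pose proof (Rmult_le_compat_r (tau - 0) (dq t) 0 ltac:(lra) H0); lra].
      unfold dq; pose proof (exp_pos (- (c * t))).
      assert (c * (v t - (a + c * RInt v 0 t)) <= 0).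
      { specialize (H t Ht).
        pose proof (Rmult_le_compat_l c (v t - (a + c * RInt v 0 t)) 0 Hc ltac:(lra)); lra. }
      pose proof (Rmult_le_compat_r (exp (- (c * t))) _ 0 ltac:(lra) H1); lra. }
  unfold q in Hq.
  replace (RInt v 0 0) with 0 in Hq by (symmetry; apply (RInt_point (V := R_CompleteNormedModule))).
  rewrite !Rmult_0_r, Rplus_0_r, Ropp_0, exp_0, Rmult_1_r in Hq.
  apply (Rmult_le_compat_r (exp (c * tau))) in Hq; [|apply Rlt_le, exp_pos].
  rewrite Rmult_assoc, <- exp_plus, Rplus_opp_l, exp_0, Rmult_1_r in Hq; exact Hq.
Qed.

Section MildSolutions.

Context {V : CompleteNormedModule R_AbsRing} (T : R -> V -> V) (phi : V -> V) (L : R).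
Hypothesis HT : semigroup T.
Hypothesis HL : 0 <= L.
Hypothesis Hphi0 : phi zero = zero.
Hypothesis HphiL : forall a b, norm (minus (phi a) (phi b)) <= L * norm (minus a b).

(** The trajectories restricted to [[0, l]]; the clamp changes the integrand only
    outside the interval of integration and keeps it continuous everywhere. *)
Definition mild_on (u : V) (y : R -> V) (l : R) : Prop :=
  forall tau, 0 <= tau <= l ->
    y tau = plus (T tau (y 0))
      (RInt (fun s => T (Rmax 0 (tau - s)) (plus u (phi (y s)))) 0 tau).

Lemma mild_on_of_formula (u : V) (y : R -> V) l :
  (forall tau, 0 < tau <= l ->
     y tau = plus (T tau (y 0))
       (RInt (fun s => T (tau - s) (plus u (phi (y s)))) 0 tau)) ->
  mild_on u y l.
Proof.
  intros H tau [[Ht| <-] Htl].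
  - rewrite H at 1 by lra; f_equal.
    apply RInt_ext; intros s Hs; rewrite Rmin_left, Rmax_right in Hs by lra.
    now rewrite Rmax_right by lra.
  - rewrite (sg_zero _ HT).
    rewrite (RInt_point (V := V)); vec V.
Qed.

Lemma phi_continuous (y : R -> V) s :
  continuous y s -> continuous (fun s => phi (y s)) s.
Proof.
  intros Hy; apply continuous_norm_lt; intros eta Heta.
  destruct (proj1 (continuous_norm_lt y s) Hy (eta / (L + 1))) as [d [Hd H]].
  { apply Rdiv_lt_0_compat; lra. }
  exists d; split; [exact Hd|]; intros t Ht; specialize (H t Ht).
  apply Rle_lt_trans with (1 := HphiL _ _).
  apply Rle_lt_trans with ((L + 1) * norm (minus (y t) (y s))).
  - apply Rmult_le_compat_r; [apply norm_ge_0|lra].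
  - apply (Rmult_lt_compat_l (L + 1)) in H; [|lra].
    replace ((L + 1) * (eta / (L + 1))) with eta in H by (field; lra); exact H.
Qed.

Lemma norm_phi (a : V) : norm (phi a) <= L * norm a.
Proof.
  apply Rle_trans with (norm (minus (phi a) (phi zero))).
  - right; f_equal; rewrite Hphi0; vec V.
  - apply Rle_trans with (1 := HphiL a zero).
    right; do 2 f_equal; vec V.
Qed.

Lemma convolution_continuous (g : R -> V) tau s :
  continuous g s -> continuous (fun s => T (Rmax 0 (tau - s)) (g s)) s.
Proof.
  intros Hg; apply (sg_continuous T HT (fun s => tau - s)); [|exact Hg].
  apply (continuous_minus (V := R_NormedModule));
    [apply continuous_const|apply continuous_id].
Qed.

Lemma convolution_constant (u : V) tau : 0 <= tau ->
  RInt (fun s => T (Rmax 0 (tau - s)) u) 0 tau = orbit_integral T tau u.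
Proof.
  intros Htau; rewrite orbit_integral_clamp by exact Htau.
  pose proof (RInt_comp_lin (fun s => T (Rmax 0 s) u) (-1) tau 0 tau
    (ex_RInt_cont _ _ _ (sg_orbit_continuous T HT u))) as E.
  replace (-1 * 0 + tau) with tau in E by ring.
  replace (-1 * tau + tau) with 0 in E by ring.
  rewrite (RInt_scal (V := V) (fun y => T (Rmax 0 (-1 * y + tau)) u)) in E.
  - rewrite <- (opp_RInt_swap (V := V) (fun s => T (Rmax 0 s) u)) in E
      by (apply ex_RInt_cont, sg_orbit_continuous, HT).
    rewrite (RInt_ext (V := V) _ (fun y => T (Rmax 0 (-1 * y + tau)) u)).
    + replace (RInt (fun y => T (Rmax 0 (-1 * y + tau)) u) 0 tau) with
        (scal (-1) (scal (-1) (RInt (fun y => T (Rmax 0 (-1 * y + tau)) u) 0 tau)))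
        by (vec V).
      rewrite E; vec V.
    + intros s _; f_equal; f_equal; ring.
  - apply (ex_RInt_ext (fun s => T (Rmax 0 (tau - s)) u)).
    + intros s _; f_equal; f_equal; ring.
    + apply ex_RInt_cont; intros s.
      apply (convolution_continuous (fun _ => u)), continuous_const.
Qed.

Lemma norm_convolution_le (g : R -> V) (v : R -> R) c tau : 0 <= tau ->
  (forall s, continuous g s) -> (forall s, continuous v s) -> 0 <= c ->
  (forall t, 0 <= t <= tau -> forall x, norm (T t x) <= c * norm x) ->
  (forall s, 0 <= s <= tau -> norm (g s) <= L * v s) ->
  norm (RInt (fun s => T (Rmax 0 (tau - s)) (g s)) 0 tau) <= c * L * RInt v 0 tau.
Proof.
  intros Htau Hg Hv Hc HcT Hgv.
  assert (E : c * L * RInt v 0 tau = RInt (fun s => c * L * v s) 0 tau).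
  { symmetry; apply (RInt_scal (V := R_CompleteNormedModule)).
    apply (ex_RInt_cont (V := R_CompleteNormedModule)), Hv. }
  rewrite E; apply norm_RInt_le_RInt; [exact Htau| | |].
  - apply ex_RInt_cont; intros s; apply convolution_continuous, Hg.
  - apply (ex_RInt_cont (V := R_CompleteNormedModule)); intros s.
    apply (continuous_mult (K := R_AbsRing) (fun _ => c * L) v);
      [apply continuous_const|apply Hv].
  - intros s Hs; rewrite Rmax_right by lra.
    apply Rle_trans with (1 := HcT (tau - s) ltac:(lra) _).
    rewrite Rmult_assoc; apply Rmult_le_compat_l; [exact Hc|now apply Hgv].
Qed.

Lemma mild_on_split (u : V) (y : R -> V) l tau :
  (forall s, continuous y s) -> mild_on u y l -> 0 <= tau <= l ->
  y tau = plus (plus (T tau (y 0)) (orbit_integral T tau u))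
    (RInt (fun s => T (Rmax 0 (tau - s)) (phi (y s))) 0 tau).
Proof.
  intros Hy Hm Ht; rewrite (Hm tau Ht) at 1.
  rewrite <- (convolution_constant u tau (proj1 Ht)).
  rewrite (RInt_ext (V := V) _ (fun s => plus (T (Rmax 0 (tau - s)) u)
                             (T (Rmax 0 (tau - s)) (phi (y s))))).
  - rewrite (RInt_plus (V := V)).
    + vec V.
    + apply ex_RInt_cont; intros s.
      apply (convolution_continuous (fun _ => u)), continuous_const.
    + apply ex_RInt_cont; intros s; apply convolution_continuous, phi_continuous, Hy.
  - intros s _; apply (linear_plus_R (T (Rmax 0 (tau - s)))), (sg_linear _ HT), Rmax_l.
Qed.

(** Samples inside a holding interval can serve as new initial states with the
    same held input. *)
Lemma mild_on_restart (u : V) (y : R -> V) l sigma :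
  (forall s, continuous y s) -> mild_on u y l -> 0 <= sigma <= l ->
  mild_on u (fun s => y (sigma + s)) (l - sigma).
Proof.
  intros Hy Hm Hs tau Ht.
  set (g := fun s => plus u (phi (y s))).
  assert (Hg : forall s, continuous g s).
  { intros s; apply (continuous_plus (V := V));
      [apply continuous_const|apply phi_continuous, Hy]. }
  rewrite (Hm (sigma + tau)) by lra; rewrite Rplus_0_r, (Hm sigma Hs).
  pose proof (sg_linear _ HT tau (proj1 Ht)) as Hl.
  rewrite (linear_plus_R _ _ _ Hl).
  rewrite Rplus_comm, (sg_add _ HT), Rplus_comm by lra.
  rewrite (RInt_add _ 0 sigma (sigma + tau))
    by (intros s; apply convolution_continuous, Hg).
  rewrite <- (RInt_linear (T tau));
    [|exact Hl|apply ex_RInt_cont; intros s; apply convolution_continuous, Hg].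
  rewrite (RInt_ext (V := V) (fun s => T tau (T (Rmax 0 (sigma - s)) (plus u (phi (y s)))))
             (fun s => T (Rmax 0 (sigma + tau - s)) (g s)) 0 sigma).
  - replace (RInt (fun s => T (Rmax 0 (sigma + tau - s)) (plus u (phi (y s)))) sigma (sigma + tau))
      with (RInt (fun s => T (Rmax 0 (tau - s)) (plus u (phi (y (sigma + s))))) 0 tau).
    + unfold g; vec V.
    + pose proof (RInt_shift (fun s => T (Rmax 0 (sigma + tau - s)) (g s)) sigma 0 tau
        ltac:(intros s; apply convolution_continuous, Hg)) as E.
      rewrite Rplus_0_r in E; unfold g in E; rewrite <- E.
      apply RInt_ext; intros s _; do 2 f_equal; ring.
  - intros s Hs'; rewrite Rmin_left, Rmax_right in Hs' by lra.
    rewrite !Rmax_right by lra; unfold g; rewrite <- (sg_add _ HT) by lra.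
    f_equal; ring.
Qed.

Lemma mild_on_unique (u : V) (y1 y2 : R -> V) l :
  (forall s, continuous y1 s) -> (forall s, continuous y2 s) ->
  mild_on u y1 l -> mild_on u y2 l -> y1 0 = y2 0 ->
  forall tau, 0 <= tau <= l -> y1 tau = y2 tau.
Proof.
  intros Hc1 Hc2 Hm1 Hm2 E0 tau Htau.
  destruct (sg_bounded T HT l) as [c [Hc HcT]].
  set (v := fun s => norm (minus (y1 s) (y2 s))).
  assert (Hv : forall s, continuous v s).
  { intros s; apply (norm_continuous (fun s => minus (y1 s) (y2 s))).
    apply (continuous_minus (V := V)); auto. }
  assert (Hle : forall t, 0 <= t <= l -> v t <= 0 + c * L * RInt v 0 t).
  { intros t Ht; rewrite Rplus_0_l; unfold v at 1.
    rewrite (mild_on_split u y1 l t Hc1 Hm1 Ht), (mild_on_split u y2 l t Hc2 Hm2 Ht), E0.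
    apply Rle_trans with
      (norm (RInt (fun s => T (Rmax 0 (t - s)) (minus (phi (y1 s)) (phi (y2 s)))) 0 t)).
    - right; f_equal.
      rewrite (RInt_ext (V := V)
        (fun s => T (Rmax 0 (t - s)) (minus (phi (y1 s)) (phi (y2 s))))
        (fun s => minus (T (Rmax 0 (t - s)) (phi (y1 s))) (T (Rmax 0 (t - s)) (phi (y2 s))))).
      + rewrite (RInt_minus (V := V))
          by (apply ex_RInt_cont; intros s; apply convolution_continuous, phi_continuous; auto).
        vec V.
      + intros s _; apply (linear_minus (T (Rmax 0 (t - s)))), (sg_linear _ HT), Rmax_l.
    - apply norm_convolution_le; [lra| |exact Hv|lra| |].
      + intros s; apply (continuous_minus (V := V)); apply phi_continuous; auto.
      + intros r Hr; apply HcT; lra.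
      + intros s _; apply HphiL. }
  assert (HcL : 0 <= c * L) by (apply Rmult_le_pos; lra).
  pose proof (gronwall v 0 (c * L) tau (proj1 Htau) HcL Hv
    (fun t Ht => Hle t ltac:(lra))) as H.
  pose proof (Hle tau Htau) as H1.
  assert (Hz : norm (minus (y1 tau) (y2 tau)) = 0).
  { pose proof (norm_ge_0 (minus (y1 tau) (y2 tau))).
    unfold v in H1 at 1; lra. }
  apply norm_eq_zero_R in Hz.
  transitivity (plus (minus (y1 tau) (y2 tau)) (y2 tau)); [vec V|rewrite Hz; vec V].
Qed.

(** With [v = |y|], the nonlinear part is at most [c L int_0^t v], so
    [v t <= a + c L int_0^t v], and Gronwall's inequality bounds
    [c L int_0^t v] itself by [a (e^(c L t) - 1)]. *)
Lemma mild_on_near_linear (u : V) (y : R -> V) l c a :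
  (forall s, continuous y s) -> mild_on u y l -> 0 <= l -> 0 <= c ->
  (forall t, 0 <= t <= l -> forall x, norm (T t x) <= c * norm x) ->
  (forall t, 0 <= t <= l -> norm (plus (T t (y 0)) (orbit_integral T t u)) <= a) ->
  forall tau, 0 <= tau <= l ->
    norm (minus (y tau) (plus (T tau (y 0)) (orbit_integral T tau u)))
      <= a * (exp (c * L * tau) - 1).
Proof.
  intros Hy Hm Hl Hc HcT Ha tau Htau.
  set (v := fun s => norm (y s)).
  assert (Hv : forall s, continuous v s) by (intros s; apply norm_continuous, Hy).
  assert (Hconv : forall t, 0 <= t <= l ->
    norm (RInt (fun s => T (Rmax 0 (t - s)) (phi (y s))) 0 t) <= c * L * RInt v 0 t).
  { intros t Ht; apply norm_convolution_le; [lra| |exact Hv|lra| |].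
    - intros s; apply phi_continuous, Hy.
    - intros r Hr; apply HcT; lra.
    - intros s _; apply norm_phi. }
  assert (HcL : 0 <= c * L) by (apply Rmult_le_pos; lra).
  pose proof (gronwall v a (c * L) tau (proj1 Htau) HcL Hv) as H.
  apply Rle_trans with (c * L * RInt v 0 tau).
  - apply Rle_trans with (2 := Hconv tau Htau); right; f_equal.
    rewrite (mild_on_split u y l tau Hy Hm Htau) at 1; vec V.
  - assert (a + c * L * RInt v 0 tau <= a * exp (c * L * tau)); [|lra].
    apply H; intros t Ht; unfold v at 1.
    rewrite (mild_on_split u y l t Hy Hm) by lra.
    apply Rle_trans with (1 := norm_triangle_R _ _).
    apply Rplus_le_compat; [apply Ha|apply Hconv]; lra.
Qed.

Lemma mild_on_growth (u : V) (y : R -> V) l c a :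
  (forall s, continuous y s) -> mild_on u y l -> 0 <= l -> 0 <= c ->
  (forall t, 0 <= t <= l -> forall x, norm (T t x) <= c * norm x) ->
  (forall t, 0 <= t <= l -> norm (plus (T t (y 0)) (orbit_integral T t u)) <= a) ->
  forall tau, 0 <= tau <= l -> norm (y tau) <= a * exp (c * L * tau).
Proof.
  intros Hy Hm Hl Hc HcT Ha tau Htau.
  pose proof (mild_on_near_linear u y l c a Hy Hm Hl Hc HcT Ha tau Htau).
  pose proof (norm_le_minus (y tau) (plus (T tau (y 0)) (orbit_integral T tau u))).
  specialize (Ha tau Htau); lra.
Qed.

End MildSolutions.

Lemma exp_increasing_le x y : x <= y -> exp x <= exp y.
Proof. intros [H| ->]; [now apply Rlt_le, exp_increasing|lra]. Qed.

(** * Real suprema *)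

Section Suprema.

Context (E : R -> Prop) (M : R).
Hypothesis HM : forall r, E r -> r <= M.

Lemma Lub_Rbar_finite r : E r -> exists l : R, Lub_Rbar E = Finite l.
Proof.
  intros Hr; destruct (Lub_Rbar_correct E) as [Hub Hlub].
  pose proof (Hub r Hr) as H1.
  assert (H2 : Rbar_le (Lub_Rbar E) M) by (apply Hlub; intros s Hs; now apply HM).
  destruct (Lub_Rbar E) as [l| |]; simpl in *; [now exists l|easy|easy].
Qed.

Lemma le_real_Lub r : E r -> r <= real (Lub_Rbar E).
Proof.
  intros Hr; destruct (Lub_Rbar_finite r Hr) as [l Hl].
  pose proof (proj1 (Lub_Rbar_correct E) r Hr) as H.
  rewrite Hl in *; exact H.
Qed.

Lemma real_Lub_le r : E r -> real (Lub_Rbar E) <= M.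
Proof.
  intros Hr; destruct (Lub_Rbar_finite r Hr) as [l Hl].
  assert (H : Rbar_le (Lub_Rbar E) M)
    by (apply (Lub_Rbar_correct E); intros s Hs; now apply HM).
  rewrite Hl in *; exact H.
Qed.

End Suprema.

(** * A norm adapted to the closed-loop semigroup *)

Section AdaptedNorm.

Context {V : CompleteNormedModule R_AbsRing} (Q : R -> V -> V) (Gamma gamma : R).
Hypothesis HQ : semigroup Q.
Hypothesis Hdecay : forall t, 0 <= t -> forall x,
  norm (Q t x) <= Gamma * exp (- gamma * t) * norm x.

(** This norm is equivalent to the given one and absorbs the constant [Gamma]:
    [Q t] contracts by [e^(-gamma t)] from time [0] on. *)
Definition adapted_norm (x : V) : R :=
  real (Lub_Rbar (fun r => exists t, 0 <= t /\ r = exp (gamma * t) * norm (Q t x))).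

Lemma weighted_orbit_bounded x r :
  (exists t, 0 <= t /\ r = exp (gamma * t) * norm (Q t x)) -> r <= Gamma * norm x.
Proof.
  intros [t [Ht ->]].
  apply Rle_trans with (exp (gamma * t) * (Gamma * exp (- gamma * t) * norm x)).
  - apply Rmult_le_compat_l; [apply Rlt_le, exp_pos|now apply Hdecay].
  - right.
    replace (- gamma * t) with (- (gamma * t)) by ring; rewrite exp_Ropp.
    field; apply Rgt_not_eq, exp_pos.
Qed.

Lemma weighted_orbit_le x t : 0 <= t ->
  exp (gamma * t) * norm (Q t x) <= adapted_norm x.
Proof.
  intros Ht; apply (le_real_Lub _ _ (weighted_orbit_bounded x)); now exists t.
Qed.

Lemma adapted_norm_le x M :
  (forall t, 0 <= t -> exp (gamma * t) * norm (Q t x) <= M) -> adapted_norm x <= M.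
Proof.
  intros H; apply real_Lub_le with (exp (gamma * 0) * norm (Q 0 x)).
  - intros r [t [Ht ->]]; now apply H.
  - exists 0; split; [lra|reflexivity].
Qed.

Lemma norm_le_adapted x : norm x <= adapted_norm x.
Proof.
  pose proof (weighted_orbit_le x 0 (Rle_refl 0)) as H.
  rewrite Rmult_0_r, exp_0, Rmult_1_l, (sg_zero _ HQ) in H; exact H.
Qed.

Lemma adapted_le_norm x : adapted_norm x <= Gamma * norm x.
Proof.
  apply adapted_norm_le; intros t Ht; apply (weighted_orbit_bounded x).
  now exists t.
Qed.

Lemma adapted_norm_triangle x y z :
  z = plus x y -> adapted_norm z <= adapted_norm x + adapted_norm y.
Proof.
  intros ->; apply adapted_norm_le; intros t Ht.
  rewrite (linear_plus_R _ _ _ (sg_linear _ HQ t Ht)).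
  apply Rle_trans with (exp (gamma * t) * (norm (Q t x) + norm (Q t y))).
  - apply Rmult_le_compat_l; [apply Rlt_le, exp_pos|apply norm_triangle_R].
  - pose proof (weighted_orbit_le x t Ht); pose proof (weighted_orbit_le y t Ht); lra.
Qed.

Lemma adapted_norm_contraction s x : 0 <= s ->
  adapted_norm (Q s x) <= exp (- gamma * s) * adapted_norm x.
Proof.
  intros Hs; apply adapted_norm_le; intros t Ht.
  rewrite <- (sg_add _ HQ) by lra.
  replace (gamma * t) with (- gamma * s + gamma * (t + s)) by ring.
  rewrite exp_plus, Rmult_assoc.
  apply Rmult_le_compat_l; [apply Rlt_le, exp_pos|].
  apply weighted_orbit_le; lra.
Qed.

End AdaptedNorm.

(** * The sampled closed loop *)

Section SampledLoop.

Context {V : CompleteNormedModule R_AbsRing}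
  (T Q : R -> V -> V) (P phi : V -> V) (L Gamma gamma : R).
Hypothesis HT : semigroup T.
Hypothesis HQ : semigroup Q.
Hypothesis HP : is_linear P.
Hypothesis Hgen : forall z y, right_derivative Q z y ->
  right_derivative T z (minus y (P z)).
Hypothesis HL : 0 <= L.
Hypothesis Hphi0 : phi zero = zero.
Hypothesis HphiL : forall a b, norm (minus (phi a) (phi b)) <= L * norm (minus a b).
Hypothesis HGamma : 1 <= Gamma.
Hypothesis Hdecay : forall t, 0 <= t -> forall x,
  norm (Q t x) <= Gamma * exp (- gamma * t) * norm x.

Variables (h eps w c1 c2 c3 sigma : R).
Hypothesis Hh : 0 < h.
Hypothesis Heps : 0 <= eps.
Hypothesis Hw0 : 0 <= w.
Hypothesis Hw : forall s, 0 <= s <= h -> forall x,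
  norm (T (h - s) (P (minus x (Q s x)))) <= w * norm x.
Hypothesis Hc1_0 : 0 <= c1.
Hypothesis Hc1 : forall t, 0 <= t <= h -> forall x, norm (sampled_map T P t x) <= c1 * norm x.
Hypothesis Hc2_0 : 0 <= c2.
Hypothesis Hc2 : forall t, 0 <= t <= h -> forall x, norm (T t x) <= c2 * norm x.
Hypothesis Hc3_0 : 0 <= c3.
Hypothesis Hc3 : forall t, 0 <= t <= h -> forall x,
  norm (orbit_integral T t (P x)) <= c3 * norm x.
Hypothesis Hsigma_0 : 0 <= sigma.
Hypothesis Hsigma : forall x, norm (orbit_integral T h (P x)) <= sigma * norm x.

Let Wh := Gamma * exp (gamma * h) * w.
Let E := exp (c2 * L * h).
Let N := adapted_norm Q gamma.
Let theta := 1 - (gamma - Wh) * exp (- gamma * h) * h.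
Let rho := theta + c1 * Gamma * (E - 1) + eps * (Gamma * (sigma + c3 * (E - 1))).

Lemma theta_lower : exp (- gamma * h) + Gamma * w * h <= theta.
Proof.
  unfold theta, Wh.
  assert (He : exp (- gamma * h) * exp (gamma * h) = 1).
  { rewrite <- exp_plus, <- exp_0; f_equal; ring. }
  replace (1 - (gamma - Gamma * exp (gamma * h) * w) * exp (- gamma * h) * h) with
    (1 - gamma * h * exp (- gamma * h)
       + Gamma * w * h * (exp (- gamma * h) * exp (gamma * h))) by ring.
  rewrite He.
  (* [1 + gamma h <= exp (gamma h)], multiplied by [exp (- gamma h)] *)
  pose proof (exp_ineq1_le (gamma * h)) as H1.
  apply (Rmult_le_compat_l (exp (- gamma * h))) in H1; [|apply Rlt_le, exp_pos].
  rewrite He in H1; lra.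
Qed.

Lemma sampled_map_contraction x : N (sampled_map T P h x) <= theta * N x.
Proof.
  pose proof (sampled_map_near T Q P HT HQ HP Hgen h w (Rlt_le _ _ Hh) Hw0 Hw x) as Hn.
  assert (Hle : N (sampled_map T P h x) <=
    N (Q h x) + N (minus (sampled_map T P h x) (Q h x))).
  { apply (adapted_norm_triangle Q Gamma gamma HQ Hdecay); vec V. }
  pose proof (adapted_norm_contraction Q Gamma gamma HQ Hdecay h x (Rlt_le _ _ Hh)) as Hc.
  pose proof (adapted_le_norm Q Gamma gamma Hdecay
    (minus (sampled_map T P h x) (Q h x))) as Hd.
  rewrite norm_minus_sym in Hd.
  pose proof (norm_le_adapted Q Gamma gamma HQ Hdecay x) as Hx.
  fold N in Hc, Hd, Hx.
  assert (Hd' : N (minus (sampled_map T P h x) (Q h x)) <= Gamma * (w * h * N x)).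
  { apply Rle_trans with (1 := Hd); apply Rmult_le_compat_l; [lra|].
    apply Rle_trans with (1 := Hn); apply Rmult_le_compat_l; [|exact Hx].
    apply Rmult_le_pos; lra. }
  assert (HN : 0 <= N x) by (pose proof (norm_ge_0 x); lra).
  pose proof theta_lower as Htheta.
  apply (Rmult_le_compat_r (N x)) in Htheta; [|exact HN]; lra.
Qed.

Lemma growth_factor_ge_1 : 1 <= E.
Proof.
  unfold E; rewrite <- exp_0; apply exp_increasing_le.
  repeat apply Rmult_le_pos; lra.
Qed.

(** With [z = y 0], the step from [z] is [Delta_h z + S_h P (xi - z)] plus the
    nonlinear remainder; the remainder is small because the linear part has norm
    at most [c1 |z| + c3 e] throughout the sampling period. *)
Lemma sampling_step (xi : V) (y : R -> V) l e :
  (forall s, continuous y s) -> mild_on T phi (P xi) y l -> h <= l ->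
  norm (minus xi (y 0)) <= e ->
  N (y h) <= (theta + c1 * Gamma * (E - 1)) * N (y 0)
             + e * (Gamma * (sigma + c3 * (E - 1))).
Proof.
  intros Hy Hm Hl He.
  pose proof growth_factor_ge_1 as HE.
  assert (Hsplit : forall t, 0 <= t <= h ->
    plus (T t (y 0)) (orbit_integral T t (P xi)) =
    plus (sampled_map T P t (y 0)) (orbit_integral T t (P (minus xi (y 0))))).
  { intros t Ht; unfold sampled_map.
    rewrite (linear_minus _ _ _ HP), (orbit_integral_minus T HT) by lra; vec V. }
  assert (Hnear : norm (minus (y h) (plus (T h (y 0)) (orbit_integral T h (P xi))))
            <= (c1 * norm (y 0) + c3 * e) * (E - 1)).
  { apply (mild_on_near_linear T phi L HT HL Hphi0 HphiL (P xi) y h c2); auto; try lra.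
    - intros t Ht; apply Hm; lra.
    - intros t Ht; rewrite Hsplit by exact Ht.
      apply Rle_trans with (1 := norm_triangle_R _ _); apply Rplus_le_compat.
      + now apply Hc1.
      + apply Rle_trans with (1 := Hc3 t Ht _); now apply Rmult_le_compat_l. }
  rewrite Hsplit in Hnear by lra.
  set (d := orbit_integral T h (P (minus xi (y 0)))) in *.
  set (r := minus (y h) (plus (sampled_map T P h (y 0)) d)) in *.
  pose proof (adapted_norm_triangle Q Gamma gamma HQ Hdecay
    (sampled_map T P h (y 0)) (plus d r) (y h) ltac:(unfold r; vec V)) as H1.
  pose proof (adapted_norm_triangle Q Gamma gamma HQ Hdecay d r (plus d r) eq_refl) as H2.
  pose proof (adapted_le_norm Q Gamma gamma Hdecay d) as Hd.
  pose proof (adapted_le_norm Q Gamma gamma Hdecay r) as Hr.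
  pose proof (norm_le_adapted Q Gamma gamma HQ Hdecay (y 0)) as H0.
  pose proof (sampled_map_contraction (y 0)) as Hc.
  fold N in H1, H2, Hd, Hr, H0.
  assert (Hd' : Gamma * norm d <= Gamma * (sigma * e)).
  { apply Rmult_le_compat_l; [lra|]; apply Rle_trans with (1 := Hsigma _).
    now apply Rmult_le_compat_l. }
  assert (Hr' : Gamma * norm r <= Gamma * ((c1 * N (y 0) + c3 * e) * (E - 1))).
  { apply Rmult_le_compat_l; [lra|]; apply Rle_trans with (1 := Hnear).
    apply Rmult_le_compat_r; [lra|].
    apply (Rmult_le_compat_l c1) in H0; lra. }
  lra.
Qed.

Hypothesis Hrho : rho < 1.

(** The error is measured against the state at the last update, so all samples
    up to the next update contract relative to that state, whatever their number. *)
Lemma held_interval_contraction (y : R -> V) (j : nat) :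
  (forall s, continuous y s) -> mild_on T phi (P (y 0)) y (INR j * h) ->
  (forall i, (i < j)%nat -> norm (minus (y (INR i * h)) (y 0)) <= eps * norm (y 0)) ->
  forall i, (i <= j)%nat -> N (y (INR i * h)) <= N (y 0) /\
    ((1 <= i)%nat -> N (y (INR i * h)) <= rho * N (y 0)).
Proof.
  intros Hy Hm Htrig.
  assert (H0 : norm (y 0) <= N (y 0)) by apply (norm_le_adapted Q Gamma gamma HQ Hdecay).
  pose proof (norm_ge_0 (y 0)); pose proof growth_factor_ge_1 as HE.
  induction i as [|i IH]; intros Hij.
  { simpl; rewrite Rmult_0_l; split; [lra|lia]. }
  enough (N (y (INR (S i) * h)) <= rho * N (y 0)).
  { split; [|auto].
    apply Rle_trans with (1 := H1); rewrite <- (Rmult_1_l (N (y 0))) at 2.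
    apply Rmult_le_compat_r; lra. }
  destruct (IH ltac:(lia)) as [IHle _].
  assert (Hi0 : 0 <= INR i * h) by (apply Rmult_le_pos; [apply pos_INR|lra]).
  assert (Hij' : INR i * h + h <= INR j * h).
  { apply le_INR in Hij; rewrite S_INR in Hij.
    apply (Rmult_le_compat_r h) in Hij; lra. }
  pose proof (mild_on_restart T phi L HT HL HphiL _ y _ (INR i * h) Hy Hm ltac:(lra)) as Hres.
  pose proof (sampling_step (y 0) (fun s => y (INR i * h + s))
    (INR j * h - INR i * h) (eps * norm (y 0))) as Hstep.
  cbv beta in Hstep; rewrite Rplus_0_r in Hstep.
  replace (INR (S i) * h) with (INR i * h + h) by (rewrite S_INR; ring).
  apply Rle_trans with
    ((theta + c1 * Gamma * (E - 1)) * N (y (INR i * h)) +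
     eps * norm (y 0) * (Gamma * (sigma + c3 * (E - 1)))).
  - apply Hstep; [|exact Hres|lra|].
    + intros s; apply (continuous_comp (fun s => INR i * h + s) y); [|apply Hy].
      apply (continuous_plus (V := R_NormedModule));
        [apply continuous_const|apply continuous_id].
    + rewrite norm_minus_sym; apply Htrig; lia.
  - assert (Htheta : 0 <= theta + c1 * Gamma * (E - 1)).
    { assert (0 <= c1 * Gamma * (E - 1)) by (repeat apply Rmult_le_pos; lra).
      enough (0 <= theta) by lra.
      pose proof theta_lower; pose proof (exp_pos (- gamma * h)).
      assert (0 <= Gamma * w * h) by (repeat apply Rmult_le_pos; lra); lra. }
    assert (Hbeta : 0 <= eps * (Gamma * (sigma + c3 * (E - 1)))).
    { assert (0 <= c3 * (E - 1)) by (apply Rmult_le_pos; lra).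
      repeat apply Rmult_le_pos; lra. }
    apply (Rmult_le_compat_l _ _ _ Htheta) in IHle.
    apply (Rmult_le_compat_l _ _ _ Hbeta) in H0.
    unfold rho; lra.
Qed.

(** The lengths of the holding intervals are at most [H = lmax h], so at most a
    fixed factor is lost in passing from the number of updates to the time. *)
Theorem sampled_loop_decay (lmax : nat) : (1 <= lmax)%nat ->
  exists Gamma0 gamma0 : R, 1 <= Gamma0 /\ 0 < gamma0 /\
  forall (x : R -> V) (t : nat -> R),
    (forall s, continuous x s) ->
    t 0%nat = 0 ->
    (forall n, exists j, (1 <= j <= lmax)%nat /\ t (S n) = t n + INR j * h /\
       mild_on T phi (P (x (t n))) (fun s => x (t n + s)) (INR j * h) /\
       forall i, (i < j)%nat ->
         norm (minus (x (t n + INR i * h)) (x (t n))) <= eps * norm (x (t n))) ->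
    forall s, 0 <= s -> norm (x s) <= Gamma0 * exp (- gamma0 * s) * norm (x 0).
Proof.
  intros Hlmax.
  set (H := INR lmax * h).
  assert (HH : h <= H).
  { unfold H; apply le_INR in Hlmax; simpl in Hlmax.
    apply (Rmult_le_compat_r h) in Hlmax; lra. }
  destruct (sg_bounded T HT H) as [M [HM HMT]].
  destruct (sampled_map_bounded T P HT HP H) as [K [HK HKb]].
  set (C := K * exp (M * L * H)).
  assert (HC : 0 <= C) by (apply Rmult_le_pos; [exact HK|apply Rlt_le, exp_pos]).
  (* [rho] may vanish, and the decay rate is the logarithm of the ratio *)
  set (q := Rmax rho (/ 2)).
  assert (Hq : rho <= q /\ / 2 <= q < 1).
  { unfold q; split; [apply Rmax_l|split; [apply Rmax_r|apply Rmax_lub_lt; lra]]. }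
  assert (Hlnq : 0 < - ln q).
  { pose proof (ln_increasing q 1 ltac:(lra) ltac:(lra)) as Hln; rewrite ln_1 in Hln; lra. }
  exists (Rmax 1 (C * Gamma / q)), (- ln q / H).
  split; [apply Rmax_l|split; [apply Rdiv_lt_0_compat; lra|]].
  intros x t Hx Ht0 Hloop.
  assert (Hshift : forall n s, continuous (fun s => x (t n + s)) s).
  { intros n s; apply (continuous_comp (fun s => t n + s) x); [|apply Hx].
    apply (continuous_plus (V := R_NormedModule));
      [apply continuous_const|apply continuous_id]. }
  assert (HNx : forall z, 0 <= N z).
  { intros z; apply Rle_trans with (norm z); [apply norm_ge_0|].
    apply (norm_le_adapted Q Gamma gamma HQ Hdecay). }
  assert (Hstep : forall n, 0 <= t n /\ t n + h <= t (S n) <= t n + H /\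
            N (x (t n)) <= q ^ n * N (x 0)).
  { intros n.
    assert (Hinc : t n + h <= t (S n) <= t n + H).
    { destruct (Hloop n) as [j [[Hj1 Hj2] [-> _]]]; unfold H.
      apply le_INR in Hj1; apply le_INR in Hj2; simpl in Hj1.
      apply (Rmult_le_compat_r h) in Hj1; [|lra].
      apply (Rmult_le_compat_r h) in Hj2; lra. }
    split; [|split; [exact Hinc|]]; clear Hinc.
    - induction n as [|n IH]; [lra|].
      destruct (Hloop n) as [j [_ [-> _]]].
      pose proof (pos_INR j); pose proof (Rmult_le_pos _ _ H0 (Rlt_le _ _ Hh)); lra.
    - induction n as [|n IH]; [rewrite Ht0; simpl; lra|].
      destruct (Hloop n) as [j [[Hj1 Hj2] [Htn [Hm Htrig]]]].
      pose proof (held_interval_contraction (fun s => x (t n + s)) j) as Hcon.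
      cbv beta in Hcon; rewrite Rplus_0_r in Hcon.
      destruct (Hcon (Hshift n) Hm Htrig j (Nat.le_refl j)) as [_ Hcj].
      rewrite Htn; apply Rle_trans with (1 := Hcj Hj1).
      simpl; rewrite Rmult_assoc.
      apply Rle_trans with (q * N (x (t n))).
      + apply Rmult_le_compat_r; [apply HNx|lra].
      + apply Rmult_le_compat_l; lra. }
  assert (Htn : forall n, INR n * h <= t n <= INR n * H).
  { induction n as [|n IH]; [rewrite Ht0; simpl; lra|].
    destruct (Hstep n) as [_ [Hinc _]]; rewrite S_INR; lra. }
  intros s Hs.
  (* the update times are unbounded, since they are at least [h] apart *)
  assert (Hcell : exists n, t n <= s <= t (S n)).
  { apply NNPP; intros Hno.
    assert (Hall : forall n, t n <= s).
    { induction n as [|n IH]; [lra|]; apply Rnot_lt_le; intros Hlt; apply Hno.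
      exists n; lra. }
    destruct (nfloor_ex (s / h)) as [n [_ Hn]]; [now apply Rdiv_le_0_compat|].
    apply (Rmult_lt_compat_r h) in Hn; [|exact Hh].
    replace (s / h * h) with s in Hn by (field; lra).
    specialize (Hall (S n)); destruct (Htn (S n)) as [Hlow _].
    rewrite S_INR in Hlow; lra. }
  destruct Hcell as [n [Hn1 Hn2]].
  destruct (Hstep n) as [_ [Hinc HNn]].
  destruct (Hloop n) as [j [[Hj1 Hj2] [Htj [Hm _]]]].
  assert (HjH : INR j * h <= H) by lra.
  assert (Hxs : norm (x s) <= C * norm (x (t n))).
  { pose proof (mild_on_growth T phi L HT HL Hphi0 HphiL
      (P (x (t n))) (fun s => x (t n + s)) (INR j * h) M (K * norm (x (t n)))
      (Hshift n) Hm ltac:(lra) ltac:(lra)) as Hg.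
    cbv beta in Hg; rewrite Rplus_0_r in Hg.
    specialize (Hg ltac:(intros r Hr; apply HMT; lra)
                   ltac:(intros r Hr; apply (HKb r); lra) (s - t n) ltac:(lra)).
    replace (t n + (s - t n)) with s in Hg by ring.
    apply Rle_trans with (1 := Hg).
    replace (C * norm (x (t n))) with (K * norm (x (t n)) * exp (M * L * H))
      by (unfold C; ring).
    apply Rmult_le_compat_l; [apply Rmult_le_pos; [exact HK|apply norm_ge_0]|].
    apply exp_increasing_le, Rmult_le_compat_l; [apply Rmult_le_pos; lra|lra]. }
  pose proof (norm_le_adapted Q Gamma gamma HQ Hdecay (x (t n))) as Hle1.
  pose proof (adapted_le_norm Q Gamma gamma Hdecay (x 0)) as Hle2; fold N in Hle1, Hle2.
  assert (Hqn : q ^ n <= exp (- (- ln q / H) * s) / q).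
  { assert (Hpow : q ^ S n = exp (INR (S n) * ln q)).
    { rewrite <- Rpower_pow by lra; reflexivity. }
    assert (Hexp : q ^ S n <= exp (- (- ln q / H) * s)).
    { rewrite Hpow; apply exp_increasing_le.
      destruct (Htn (S n)) as [_ Hup].
      replace (INR (S n) * ln q) with (ln q / H * (INR (S n) * H)) by (field; lra).
      replace (- (- ln q / H) * s) with (ln q / H * s) by (field; lra).
      assert (Hneg : 0 <= - ln q / H) by (apply Rdiv_le_0_compat; lra).
      assert (- ln q / H * s <= - ln q / H * (INR (S n) * H))
        by (apply Rmult_le_compat_l; lra).
      unfold Rdiv in *; lra. }
    simpl in Hexp; apply Rmult_le_reg_l with q; [lra|].
    replace (q * (exp (- (- ln q / H) * s) / q)) with (exp (- (- ln q / H) * s))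
      by (field; lra).
    exact Hexp. }
  pose proof (norm_ge_0 (x 0)) as Hx0.
  apply Rle_trans with (C * (exp (- (- ln q / H) * s) / q * (Gamma * norm (x 0)))).
  - apply Rle_trans with (1 := Hxs); apply Rmult_le_compat_l; [exact HC|].
    apply Rle_trans with (1 := Hle1); apply Rle_trans with (1 := HNn).
    apply Rmult_le_compat; [apply pow_le; lra|apply HNx|exact Hqn|exact Hle2].
  - replace (C * (exp (- (- ln q / H) * s) / q * (Gamma * norm (x 0)))) with
      (C * Gamma / q * (exp (- (- ln q / H) * s) * norm (x 0))) by (field; lra).
    rewrite Rmult_assoc; apply Rmult_le_compat_r; [|apply Rmax_r].
    apply Rmult_le_pos; [apply Rlt_le, exp_pos|exact Hx0].
Qed.

End SampledLoop.

(** * Operator norms on Hilbert spaces *)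

Section OperatorNorms.

Context {k : scalar_field} {X Y : HilbertSpace k}.

Lemma real_linear (l : X -> Y) :
  is_linear l -> @is_linear R_AbsRing (real_module X) (real_module Y) l.
Proof.
  intros [Hp Hs Hn]; split; [exact Hp| |exact Hn].
  intros r x; exact (Hs (of_real k r) x).
Qed.

Definition real_homogeneous (l : X -> Y) : Prop :=
  forall (r : R) (x : X), l (real_scal r x) = real_scal r (l x).

(** The existence of some bound [M] excludes that the supremum is infinite and
    is projected to [0]. *)
Lemma opnorm_spec (l : X -> Y) M :
  real_homogeneous l -> (forall x, norm (l x) <= M * norm x) -> 0 <= M ->
  0 <= opnorm l <= M /\ forall x, norm (l x) <= opnorm l * norm x.
Proof.
  intros Hl HM HM0.
  set (E := fun r => exists x : X, norm x <= 1 /\ r = norm (l x)).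
  assert (HE : forall r, E r -> r <= M).
  { intros r [x [Hx ->]]; apply Rle_trans with (1 := HM x).
    rewrite <- (Rmult_1_r M) at 2; now apply Rmult_le_compat_l. }
  assert (HEl : forall x, norm x <= 1 -> norm (l x) <= opnorm l).
  { intros x Hx; apply (le_real_Lub E M HE); now exists x. }
  assert (H0 : norm (zero : X) <= 1) 
    by (rewrite (norm_zero (V := X) : norm (zero : X) = 0); lra).
  split; [split|].
  - apply Rle_trans with (2 := HEl zero H0), norm_ge_0.
  - apply (real_Lub_le E M HE (norm (l zero))); now exists zero.
  - intros x; destruct (norm_ge_0 x) as [Hx|Hx].
    + assert (Hn : @norm R_AbsRing (real_module X) (real_scal (/ norm x) x) = 1).
      { etransitivity; [exact (norm_scal_eq (V := real_module X) (/ norm x) x)|].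
        rewrite Rabs_pos_eq by now apply Rlt_le, Rinv_0_lt_compat.
        apply Rinv_l, Rgt_not_eq, Hx. }
      pose proof (HEl (real_scal (/ norm x) x) (Req_le _ _ Hn)) as H.
      rewrite Hl in H.
      assert (Hs : norm (real_scal (/ norm x) (l x)) = / norm x * norm (l x)).
      { etransitivity; [exact (norm_scal_eq (V := real_module Y) (/ norm x) (l x))|].
        rewrite Rabs_pos_eq by now apply Rlt_le, Rinv_0_lt_compat.
        reflexivity. }
      rewrite Hs in H; apply (Rmult_le_compat_r (norm x)) in H; [|lra].
      replace (/ norm x * norm (l x) * norm x) with (norm (l x)) in H by (field; lra).
      exact H.
    + rewrite <- Hx, Rmult_0_r; specialize (HM x); rewrite <- Hx in HM; lra.
Qed.

Lemma sup_opnorm_spec (l : R -> X -> Y) h M : 0 <= h ->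
  (forall s, 0 <= s <= h -> real_homogeneous (l s)) ->
  (forall s, 0 <= s <= h -> forall x, norm (l s x) <= M * norm x) -> 0 <= M ->
  0 <= sup_on 0 h (fun s => opnorm (l s)) /\
  forall s, 0 <= s <= h -> forall x,
    norm (l s x) <= sup_on 0 h (fun s => opnorm (l s)) * norm x.
Proof.
  intros Hh Hl HM HM0.
  set (E := fun r => exists s, 0 <= s <= h /\ r = opnorm (l s)).
  assert (HE : forall r, E r -> r <= M).
  { intros r [s [Hs ->]]; apply (opnorm_spec (l s) M); auto. }
  assert (HEl : forall s, 0 <= s <= h ->
            opnorm (l s) <= sup_on 0 h (fun s => opnorm (l s))).
  { intros s Hs; apply (le_real_Lub E M HE); now exists s. }
  split.
  - apply Rle_trans with (2 := HEl 0 ltac:(lra)).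
    apply (opnorm_spec (l 0) M); [apply Hl|apply HM|exact HM0]; lra.
  - intros s Hs x; apply Rle_trans with (opnorm (l s) * norm x).
    + apply (opnorm_spec (l s) M); auto.
    + apply Rmult_le_compat_r; [apply norm_ge_0|now apply HEl].
Qed.

End OperatorNorms.

(** * The event-triggered closed loop *)

(** Trajectories are continuous on the half line only; this extends them by
    their initial value. *)
Lemma clamped_continuous {V : UniformSpace} (y : R -> V) :
  continuous_on (fun s => 0 <= s) y ->
  forall s, continuous (fun s => y (Rmax 0 s)) s.
Proof.
  intros Hy s; pose proof (Hy (Rmax 0 s) (Rmax_l 0 s)) as H.
  apply (filterlim_comp _ _ _ (Rmax 0) y _ (within (fun s => 0 <= s) (locally (Rmax 0 s))));
    [|exact H].
  intros A [[d Hd] HA]; exists (mkposreal d Hd); intros t Ht.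
  apply HA; [|apply Rmax_l].
  change (Rabs (t - s) < d) in Ht; change (Rabs (Rmax 0 t - Rmax 0 s) < d).
  apply Rle_lt_trans with (2 := Ht).
  unfold Rmax; destruct (Rle_dec 0 t), (Rle_dec 0 s);
    unfold Rabs; repeat destruct Rcase_abs; lra.
Qed.

Lemma mild_on_ext {V : CompleteNormedModule R_AbsRing} (T : R -> V -> V) (phi : V -> V)
    (u : V) (y1 y2 : R -> V) l :
  (forall s, 0 <= s -> y1 s = y2 s) -> mild_on T phi u y1 l -> mild_on T phi u y2 l.
Proof.
  intros E H tau Ht; rewrite <- !E by lra; rewrite (H tau Ht) at 1; f_equal.
  apply RInt_ext; intros s Hs; rewrite Rmin_left, Rmax_right in Hs by lra.
  now rewrite E by lra.
Qed.

(** The next update time is either [lmax] periods after the last one or the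
    first violation time; both are sampling times, and no sample strictly before
    it is a violation. *)
Lemma next_update_on_grid (k : scalar_field) (X : HilbertSpace k) h eps lmax (m : nat)
    (y : R -> X) tk1 :
  0 < h -> (1 <= lmax)%nat -> next_update_time h eps lmax (INR m * h) y tk1 ->
  exists j, (1 <= j <= lmax)%nat /\ tk1 = INR m * h + INR j * h /\
    forall i, (1 <= i < j)%nat -> norm (minus (y (INR i * h)) (y 0)) <= eps * norm (y 0).
Proof.
  intros Hh Hlmax [tbar [Hmin Htk]].
  assert (Hno : forall j, tk1 = INR m * h + INR j * h ->
    forall i, (1 <= i < j)%nat -> norm (minus (y (INR i * h)) (y 0)) <= eps * norm (y 0)).
  { intros j Hj i Hi; apply Rnot_lt_le; intros Hviol.
    assert (Hin : violation_times h eps (INR m * h) y (INR (m + i) * h)).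
    { exists (m + i)%nat; rewrite plus_INR.
      replace ((INR m + INR i) * h - INR m * h) with (INR i * h) by ring.
      assert (1 <= INR i) by (apply (le_INR 1); lia).
      pose proof (Rmult_le_compat_r h _ _ (Rlt_le _ _ Hh) H).
      repeat split; [lia|lra|exact Hviol]. }
    assert (Hlt : INR (m + i) * h < tk1).
    { rewrite plus_INR, Hj, Rmult_plus_distr_r; apply Rplus_lt_compat_l.
      apply Rmult_lt_compat_r; [exact Hh|]; apply lt_INR; lia. }
    destruct tbar as [r| |]; simpl in Hmin, Htk.
    - destruct Hmin as [_ Hmin]; specialize (Hmin _ Hin).
      injection Htk as Htk.
      pose proof (Rmin_r (INR m * h + INR lmax * h) r); lra.
    - exact (Hmin _ Hin).
    - exact Hmin. }
  assert (Hlm : (1 <= lmax <= lmax)%nat) by lia.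
  destruct tbar as [r| |]; simpl in Hmin, Htk.
  - injection Htk as Htk.
    destruct (Rle_dec (INR m * h + INR lmax * h) r) as [Hle|Hgt].
    + rewrite Rmin_left in Htk by exact Hle.
      exists lmax; split; [exact Hlm|split; [exact Htk|now apply Hno]].
    + rewrite Rmin_right in Htk by lra; subst r.
      destruct Hmin as [[l [Hl1 [Hl [Hgt' _]]]] _].
      assert (Hml : (m < l)%nat).
      { apply INR_lt, Rmult_lt_reg_r with h; lra. }
      assert (Hll : (l < m + lmax)%nat).
      { apply INR_lt; rewrite plus_INR; apply Rmult_lt_reg_r with h; lra. }
      assert (Ej : tk1 = INR m * h + INR (l - m) * h).
      { rewrite minus_INR by lia; rewrite Hl; ring. }
      exists (l - m)%nat; split; [lia|split; [exact Ej|now apply Hno]].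
  - injection Htk as Htk.
    exists lmax; split; [exact Hlm|split; [exact Htk|now apply Hno]].
  - destruct Hmin.
Qed.

Lemma generates_semigroup (k : scalar_field) (X : HilbertSpace k)
    (A : partial_operator X) (T : R -> X -> X) :
  generates A T -> @semigroup (real_module X) T.
Proof.
  intros [[Hl [H0 [Ha Hr]]] _]; split; [|exact H0|exact Ha|exact Hr].
  intros t Ht; apply real_linear, Hl, Ht.
Qed.

(** The operators [A + P] and [A] have the same domain and differ there by [P]. *)
Lemma generates_perturbation (k : scalar_field) (X : HilbertSpace k)
    (A : partial_operator X) (P : X -> X) (T Q : R -> X -> X) :
  generates A T -> generates (bounded_perturbation A P) Q ->
  forall z y : real_module X, @right_derivative (real_module X) Q z y ->
    @right_derivative (real_module X) T z (minus y (P z : real_module X)).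
Proof.
  intros [_ HA] [_ HAP] z y Hzy.
  apply right_derivative_iff in Hzy; apply right_derivative_iff.
  destruct (proj2 (HAP z y) Hzy) as [Hdom Happ].
  apply (proj1 (HA z (minus y (P z)))); split; [exact Hdom|].
  set (V := real_module X) in *.
  transitivity (minus (plus (app A z : V) (P z : V)) (P z : V)); [vec V|].
  exact (f_equal (fun v : V => minus v (P z : V)) Happ).
Qed.

(** The triggering rule concerns the held trajectory [y]; it is turned into a
    statement about [x] by uniqueness of mild solutions on the holding interval. *)
Lemma closed_loop_grid (k : scalar_field) (X U : HilbertSpace k)
    (A : partial_operator X) (T : R -> X -> X) (B : U -> X) (F : X -> U) (phi : X -> X)
    L h eps lmax (x0 : X) x t :
  generates A T -> 0 <= L ->
  (forall a b : X, norm (minus (phi a) (phi b)) <= L * norm (minus a b)) ->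
  0 < h -> 0 <= eps -> (1 <= lmax)%nat ->
  closed_loop_solution T B F phi h eps lmax x0 x t ->
  forall n, exists j, (1 <= j <= lmax)%nat /\ t (S n) = t n + INR j * h /\
    @mild_on (real_module X) T phi (B (F (x (t n)))) (fun s => x (Rmax 0 (t n + s)))
      (INR j * h) /\
    forall i, (i < j)%nat ->
      norm (minus (x (t n + INR i * h)) (x (t n))) <= eps * norm (x (t n)).
Proof.
  intros HT HL HphiL Hh Heps Hlmax [_ [Hxc [Ht0 Hloop]]].
  pose proof (generates_semigroup _ _ _ _ HT) as HTs.
  assert (Hgrid : forall n, exists m : nat, t n = INR m * h).
  { induction n as [|n [m Hm]]; [exists 0%nat; simpl; lra|].
    destruct (Hloop n) as [[y [_ Hnext]] _]; rewrite Hm in Hnext.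
    destruct (next_update_on_grid _ _ h eps lmax m y _ Hh Hlmax Hnext) as [j [_ [-> _]]].
    exists (m + j)%nat; rewrite plus_INR; ring. }
  intros n; destruct (Hgrid n) as [m Hm].
  destruct (Hloop n) as [[y [[Hy0 [Hyc Hyf]] Hnext]] Hxf].
  rewrite Hm in Hnext.
  destruct (next_update_on_grid _ _ h eps lmax m y _ Hh Hlmax Hnext) as [j [Hj [Etn Htrig]]].
  rewrite <- Hm in Etn.
  assert (Htn : 0 <= t n).
  { rewrite Hm; apply Rmult_le_pos; [apply pos_INR|lra]. }
  set (u := B (F (x (t n))) : real_module X).
  assert (Hmx : @mild_on (real_module X) T phi u (fun s => x (Rmax 0 (t n + s))) (INR j * h)).
  { apply (mild_on_ext (V := real_module X) T phi u (fun s => x (t n + s))).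
    - intros s Hs; now rewrite Rmax_right by lra.
    - apply (mild_on_of_formula (V := real_module X) T phi HTs); intros tau Htau.
      rewrite Rplus_0_r; apply Hxf; lra. }
  assert (Hmy : @mild_on (real_module X) T phi u (fun s => y (Rmax 0 s)) (INR j * h)).
  { apply (mild_on_ext (V := real_module X) T phi u y).
    - intros s Hs; now rewrite Rmax_right by lra.
    - apply (mild_on_of_formula (V := real_module X) T phi HTs); intros tau Htau.
      rewrite Hy0; apply Hyf; lra. }
  exists j; split; [exact Hj|split; [exact Etn|split; [exact Hmx|]]].
  intros i Hi; destruct i as [|i].
  { simpl; rewrite Rmult_0_l, Rplus_0_r.
    apply Rle_trans with 0; [right; exact (norm_minus_self (V := real_module X) _)|].
    apply Rmult_le_pos; [exact Heps|apply norm_ge_0]. }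
  assert (Hi0 : 0 <= INR (S i) * h) by (apply Rmult_le_pos; [apply pos_INR|lra]).
  assert (E : x (Rmax 0 (t n + INR (S i) * h)) = y (Rmax 0 (INR (S i) * h))).
  { apply (mild_on_unique (V := real_module X) T phi L HTs HL HphiL u
      (fun s => x (Rmax 0 (t n + s))) (fun s => y (Rmax 0 s)) (INR j * h)); auto.
    - intros s; apply (continuous_comp (fun s => t n + s) (fun s => x (Rmax 0 s))).
      + apply (continuous_plus (V := R_NormedModule));
          [apply continuous_const|apply continuous_id].
      + apply (clamped_continuous x Hxc).
    - apply (clamped_continuous y Hyc).
    - rewrite Rplus_0_r, !Rmax_right by lra; now symmetry.
    - split; [exact Hi0|]; apply Rmult_le_compat_r; [lra|]; apply le_INR; lia. }
  rewrite !Rmax_right in E by lra.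
  rewrite E, <- Hy0; apply Htrig; lia.
Qed.

Theorem corollary4p8 (k : scalar_field) (X U : HilbertSpace k)
  (A : partial_operator X) (T TBF : R -> X -> X)
  (B : U -> X) (F : X -> U) (phi : X -> X) (L Gamma gamma : R)
  (HT : generates A T)
  (HB : is_linear B)
  (HF : compact_operator F)
  (HL : 0 <= L)
  (Hphi0 : phi zero = zero)
  (HphiL : forall xi1 xi2 : X,
     norm (minus (phi xi1) (phi xi2)) <= L * norm (minus xi1 xi2))
  (HTBF : generates (bounded_perturbation A (fun x => B (F x))) TBF)
  (HGamma : 1 <= Gamma)
  (Hgamma : 0 < gamma)
  (Hstab : forall t, 0 <= t -> opnorm (TBF t) <= Gamma * exp (- gamma * t))
  (HSF : forall h, 0 < h -> W T TBF B F Gamma gamma h < gamma ->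
     ~ (forall x : X, S_op T B h (F x) = zero)) :
  forall (lmax : nat), (1 <= lmax)%nat ->
  forall (h eps : R), 0 < h -> 0 <= eps ->
  let c1 := sup_on 0 h (fun tau => opnorm (Delta_op T B F tau)) in
  let c2 := sup_on 0 h (fun tau => opnorm (T tau)) in
  let c3 := sup_on 0 h (fun tau => opnorm (fun x : X => S_op T B tau (F x))) in
  eps < ((gamma - W T TBF B F Gamma gamma h) * exp (- gamma * h) * h
           - c1 * Gamma * (exp (c2 * L * h) - 1))
        / (Gamma * (opnorm (fun x : X => S_op T B h (F x))
                    + c3 * (exp (c2 * L * h) - 1))) ->
  exponentially_stable T B F phi h eps lmax.
Proof.
  intros lmax Hlmax h eps Hh Heps c1 c2 c3 Hcond.
  set (V := real_module X).
  set (P := (fun x => B (F x)) : V -> V).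
  pose proof (generates_semigroup _ _ _ _ HT : @semigroup V T) as HTs.
  pose proof (generates_semigroup _ _ _ _ HTBF : @semigroup V TBF) as HQs.
  assert (HP : is_linear P).
  { apply (is_linear_comp (U := V) (V := real_module U) (W := V) F B);
      apply real_linear; [apply HF|exact HB]. }
  pose proof (generates_perturbation _ _ _ _ _ _ HT HTBF) as Hgen.
  destruct (sg_bounded (V := V) T HTs h) as [M [HM HMT]].
  destruct (sampled_map_bounded (V := V) T P HTs HP h) as [K [HK HKb]].
  destruct (linear_norm _ HP) as [p [Hp HPp]].
  assert (HS : forall t, 0 <= t <= h -> forall x : X,
            norm (S_op T B t (F x)) <= h * (M * p) * norm x).
  { intros t Ht x.
    apply Rle_trans with (t * (M * norm (P x))).
    - apply (orbit_integral_bounded (V := V) T HTs t M (P x)); [lra|].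
      intros s Hs; apply HMT; lra.
    - rewrite !Rmult_assoc; apply Rmult_le_compat; [lra| |lra|].
      + apply Rmult_le_pos; [lra|apply norm_ge_0].
      + apply Rmult_le_compat_l; [lra|apply HPp]. }
  assert (HhMp : 0 <= h * (M * p)) by (repeat apply Rmult_le_pos; lra).
  assert (HShom : forall t, 0 <= t <= h ->
            real_homogeneous (fun x : X => S_op T B t (F x))).
  { intros t Ht r x.
    transitivity (orbit_integral (V := V) T t (scal r (P x))).
    - exact (f_equal (orbit_integral (V := V) T t) (linear_scal_R P r x HP)).
    - apply (orbit_integral_scal (V := V) T HTs); lra. }
  assert (HQb : forall t, 0 <= t -> forall x : V,
            norm (TBF t x) <= Gamma * exp (- gamma * t) * norm x).
  { intros t Ht x.
    destruct (linear_norm _ (sg_linear _ HQs t Ht)) as [q [Hq Hqb]].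
    destruct (opnorm_spec (TBF t) q) as [_ Hop]; [|exact Hqb|lra|].
    - intros r z; exact (linear_scal_R (V := V) (Y := V) (TBF t) r z (sg_linear _ HQs t Ht)).
    - apply Rle_trans with (1 := Hop x).
      apply Rmult_le_compat_r; [apply norm_ge_0|now apply Hstab]. }
  destruct (sup_opnorm_spec (Delta_op T B F) h K) as [Hc1_0 Hc1].
  { lra. }
  { intros t Ht r x; apply (sampled_map_scal (V := V) T P HTs HP); lra. }
  { exact HKb. }
  { exact HK. }
  fold c1 in Hc1_0, Hc1.
  destruct (sup_opnorm_spec T h M) as [Hc2_0 Hc2].
  { lra. }
  { intros t Ht r x; apply (linear_scal_R (V := V) (Y := V) (T t)), (sg_linear _ HTs); lra. }
  { exact HMT. }
  { lra. }
  fold c2 in Hc2_0, Hc2.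
  destruct (sup_opnorm_spec (fun t x => S_op T B t (F x)) h (h * (M * p)))
    as [Hc3_0 Hc3]; [lra|exact HShom|exact HS|exact HhMp|].
  fold c3 in Hc3_0, Hc3.
  destruct (opnorm_spec (fun x : X => S_op T B h (F x)) (h * (M * p)))
    as [[Hsig0 _] Hsig]; [apply HShom; lra|apply HS; lra|exact HhMp|].
  set (sigma := opnorm (fun x : X => S_op T B h (F x))) in *.
  set (mis := fun t (x : X) => T (h - t) (B (F (minus x (TBF t x))))).
  assert (Hmis : 0 <= sup_on 0 h (fun t => opnorm (mis t)) /\
    forall s, 0 <= s <= h -> forall x,
      norm (mis s x) <= sup_on 0 h (fun t => opnorm (mis t)) * norm x).
  { apply (sup_opnorm_spec mis h (M * (p * (1 + Gamma)))); [lra| | |].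
    - intros s Hs r x.
      assert (Hl : is_linear (TBF s : V -> V)) by (apply (sg_linear _ HQs); lra).
      assert (HlT : is_linear (T (h - s) : V -> V)) by (apply (sg_linear _ HTs); lra).
      assert (E : minus (scal r (x : V)) (TBF s (scal r (x : V)))
                = scal r (minus (x : V) (TBF s x))).
      { rewrite (linear_scal_R (V := V) (Y := V) (TBF s) r x Hl); vec V. }
      transitivity (T (h - s) (P (scal r (minus (x : V) (TBF s x))))).
      + exact (f_equal (fun v : V => T (h - s) (P v)) E).
      + rewrite (linear_scal_R P r _ HP).
        exact (linear_scal_R (V := V) (Y := V) (T (h - s)) r _ HlT).
    - intros s Hs x.
      apply Rle_trans with (1 := HMT (h - s) ltac:(lra) (P (minus (x : V) (TBF s x)))).
      rewrite Rmult_assoc; apply Rmult_le_compat_l; [lra|].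
      apply Rle_trans with (1 := HPp (minus (x : V) (TBF s x))).
      rewrite Rmult_assoc; apply Rmult_le_compat_l; [lra|].
      apply Rle_trans with (1 := norm_minus_le (x : V) (TBF s x)).
      rewrite Rmult_plus_distr_r, Rmult_1_l; apply Rplus_le_compat_l.
      apply Rle_trans with (1 := HQb s ltac:(lra) x).
      apply Rmult_le_compat_r; [apply norm_ge_0|].
      rewrite <- (Rmult_1_r Gamma) at 2; apply Rmult_le_compat_l; [lra|].
      rewrite <- exp_0; apply exp_increasing_le.
      pose proof (Rmult_le_pos gamma s ltac:(lra) ltac:(lra)); lra.
    - repeat apply Rmult_le_pos; lra. }
  destruct Hmis as [Hw0 Hw].
  set (w := sup_on 0 h (fun t => opnorm (mis t))) in *.
  change (W T TBF B F Gamma gamma h) with (Gamma * exp (gamma * h) * w) in Hcond.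
  specialize (HSF h Hh).
  change (W T TBF B F Gamma gamma h) with (Gamma * exp (gamma * h) * w) in HSF.
  assert (HE : 1 <= exp (c2 * L * h)).
  { rewrite <- exp_0; apply exp_increasing_le; repeat apply Rmult_le_pos; lra. }
  set (D := Gamma * (sigma + c3 * (exp (c2 * L * h) - 1))) in *.
  set (num := (gamma - Gamma * exp (gamma * h) * w) * exp (- gamma * h) * h
                - c1 * Gamma * (exp (c2 * L * h) - 1)) in *.
  assert (Hc3E : 0 <= c3 * (exp (c2 * L * h) - 1)) by (apply Rmult_le_pos; lra).
  assert (HDpos : 0 < D).
  { destruct (Rlt_le_dec (Gamma * exp (gamma * h) * w) gamma) as [HW|HW].
    - apply Rmult_lt_0_compat; [lra|].
      enough (sigma <> 0) by lra; intros Hz.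
      apply (HSF HW); intros x; apply (norm_eq_zero_R (V := V)), Rle_antisym.
      + specialize (Hsig x); rewrite Hz, Rmult_0_l in Hsig; exact Hsig.
      + apply norm_ge_0.
    - (* otherwise the threshold would be nonpositive *)
      exfalso.
      assert (Hnum : num <= 0).
      { assert (0 <= c1 * Gamma * (exp (c2 * L * h) - 1))
          by (repeat apply Rmult_le_pos; lra).
        assert (0 <= (Gamma * exp (gamma * h) * w - gamma) * exp (- gamma * h) * h)
          by (repeat apply Rmult_le_pos; try lra; apply Rlt_le, exp_pos).
        unfold num; lra. }
      assert (HD0 : 0 <= D) by (apply Rmult_le_pos; lra).
      assert (Hinv : 0 <= / D).
      { destruct HD0 as [HD0|HD0]; [now apply Rlt_le, Rinv_0_lt_compat|].
        rewrite <- HD0, Rinv_0; lra. }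
      pose proof (Rmult_le_compat_r (/ D) num 0 Hinv Hnum); unfold Rdiv in Hcond; lra. }
  assert (Hrho : eps * D < num).
  { apply (Rmult_lt_compat_r D) in Hcond; [|exact HDpos].
    replace (num / D * D) with num in Hcond by (field; lra); exact Hcond. }
  destruct (sampled_loop_decay (V := V) T TBF P phi L Gamma gamma HTs HQs HP Hgen HL
    Hphi0 HphiL HGamma HQb h eps w c1 c2 c3 sigma Hh Heps Hw0 Hw Hc1_0 Hc1 Hc2_0 Hc2
    Hc3_0 Hc3 Hsig0 Hsig ltac:(unfold num, D in Hrho; lra) lmax Hlmax)
    as [Gamma0 [gamma0 [HG0 [Hg0 Hdec]]]].
  exists Gamma0, gamma0; split; [exact HG0|split; [exact Hg0|]].
  intros x0 x t Hsol s Hs.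
  pose proof (closed_loop_grid k X U A T B F phi L h eps lmax x0 x t HT HL HphiL Hh Heps
    Hlmax Hsol) as Hgrid.
  destruct Hsol as [Hx0 [Hxc [Ht0 _]]].
  assert (Htn : forall n, 0 <= t n).
  { induction n as [|n IH]; [lra|].
    destruct (Hgrid n) as [j [_ [-> _]]].
    pose proof (Rmult_le_pos _ _ (pos_INR j) (Rlt_le _ _ Hh)); lra. }
  specialize (Hdec (fun s => x (Rmax 0 s)) t (clamped_continuous x Hxc) Ht0).
  rewrite <- Hx0.
  assert (Hfin : norm (x (Rmax 0 s)) <= Gamma0 * exp (- gamma0 * s) * norm (x (Rmax 0 0))).
  { apply Hdec; [|exact Hs]; intros n.
    destruct (Hgrid n) as [j [Hj [Etn [Hm Htrig]]]].
    exists j; split; [exact Hj|split; [exact Etn|]].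
    cbv beta; rewrite (Rmax_right 0 (t n)) by apply Htn.
    split; [exact Hm|]; intros i Hi.
    rewrite Rmax_right; [now apply Htrig|].
    pose proof (Rmult_le_pos _ _ (pos_INR i) (Rlt_le _ _ Hh)); specialize (Htn n); lra. }
  rewrite !Rmax_right in Hfin by lra; exact Hfin.
Qed.
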